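(* Let $(N,g,\nabla)$ be a Weyl manifold of dimension $n\ge3$ with curvature tensor $R$, conjugate curvature tensor $R^\star$, length curvature operator $\mathcal F$ and directional curvature $\mathcal K$. Let $H(R)$ be the Higa term of $R$. Then $$g(\mathcal F(x,y)z,w)=\tfrac12(R-R^\star)(x,y,z,w)=\tfrac12\big(H(R)(x,y,z,w)+H(R)(x,y,w,z)\big),$$ $$g(\mathcal K(x,y)z,w)=\tfrac12(R+R^\star)(x,y,z,w)=(\alpha_1+\alpha_2+\alpha_6)(R)(x,y,z,w)+\tfrac12\big(H(R)(x,y,z,w)-H(R)(x,y,w,z)\big).$$
   Context: A Weyl manifold is a triple $(N,g,\nabla)$ with $g$ a semi-Riemannian metric and $\nabla$ a torsion free connection on $TN$ such that $\nabla g=-2\phi\otimes g$ for some smooth $1$-form $\phi$. $\mathcal R(x,y)z:=(\nabla_x\nabla_y-\nabla_y\nabla_x-\nabla_{[x,y]})z$, $R(x,y,z,w):=g(\mathcal R(x,y)z,w)$, $\operatorname{Ric}(x,y):=g^{ij}R(e_i,x,y,e_j)$, $\tau_g:=g^{ij}\operatorname{Ric}(e_i,e_j)$; $S$, $\Lambda$ denote symmetrization and anti-symmetrization of $(0,2)$-tensors. Conjugate curvature tensor: $R^\star(x,y,w,z):=-R(x,y,z,w)$. Length curvature: $F:=-\frac2n\Lambda\operatorname{Ric}$, with operator $\mathcal F(x,y)z:=F(x,y)z$. Directional curvature: $\mathcal K(x,y)z:=\mathcal R(x,y)z-F(x,y)z$. For bilinear forms: $(\theta_1\cdot\theta_2)(x,y,z,w):=\theta_1(x,y)\theta_2(z,w)$,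 and for an integer $r$, $(\theta_1\wedge_r\theta_2)(x,y,z,w):=\theta_1(x,z)\theta_2(y,w)-\theta_1(y,z)\theta_2(x,w)-r[\theta_1(x,w)\theta_2(y,z)-\theta_1(y,w)\theta_2(x,z)]$, $\wedge:=\wedge_0$. Components of the $A$-decomposition of $R$: $\alpha_1(R)=-\frac1{n(n-1)}\tau_g\,g\wedge g$, $\alpha_2(R)=-\frac1{n-2}S\operatorname{Ric}\wedge_1g+\frac2{n(n-2)}\tau_g\,g\wedge g$, $\alpha_6(R)=R+\frac2n\Lambda\operatorname{Ric}\cdot g+\frac1n\Lambda\operatorname{Ric}\wedge_1g+\frac1{n-2}S\operatorname{Ric}\wedge_1g-\frac1{(n-1)(n-2)}\tau_g\,g\wedge g$. Higa term: with $\mathfrak W$ the space of $A\in\otimes^4T_P^*N$ that are skew in the first two arguments, satisfy $A(x,y,z,w)+A(y,z,x,w)+A(z,x,y,w)=0$ and $A(x,y,z,w)+A(x,y,w,z)=-\frac4n(\Lambda\operatorname{Ric}(A))(x,y)g(z,w)$ (where $\operatorname{Ric}(A)(x,y):=g^{ij}A(e_i,x,y,e_j)$), $\mathfrak A\subset\mathfrak W$ the subspace with $A(x,y,z,w)+A(x,y,w,z)=0$, and $\mathfrak P=\{2\varphi\cdot g+\varphi\wedge_1g:\varphi\in\Lambda^2T^*_PN\}$, one has $\mathfrak W=\mathfrak A\oplus\mathfrak P$, and $H(R)$ is the projection of $R$ on $\mathfrak P$ along $\mathfrak A$; explicitly $H(R)=-\frac1n(2\Lambda\operatorname{Ric}\cdot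 g+\Lambda\operatorname{Ric}\wedge_1g)$. *)

(* Defs.v *)
From HB Require Import structures.
From mathcomp Require Import all_boot all_order all_algebra.
From mathcomp Require Import ring.
From mathcomp Require Import all_classical all_reals all_analysis.

Set Implicit Arguments.
Unset Strict Implicit.
Unset Printing Implicit Defensive.

Import Order.TTheory GRing.Theory Num.Theory.
Import numFieldNormedType.Exports.
Local Open Scope classical_set_scope.
Local Open Scope ring_scope.

Section SmoothFunctions.
Context {R : realType} {n : nat}.
Local Notation E := 'rV[R]_n.
Implicit Types (U : set E) (f g : E -> R).

Definition partial (i : 'I_n) f : E -> R := 'D_(delta_mx 0 i) f.

(* Only used for an open [U]. *)
Fixpoint Ck (k : nat) U f : Prop :=
  (forall x, U x -> {for x, continuous f}) /\
  (if k is k'.+1 then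
     forall i, (forall x, U x -> derivable f x (delta_mx 0 i)) /\
               Ck k' U (partial i f)
   else True).

Definition smooth_on U f : Prop := forall k, Ck k U f.

Lemma Ck_cont k U f : Ck k U f -> forall x, U x -> {for x, continuous f}.
Proof. by case: k => [|k] []. Qed.

Lemma Ck_eq k U f g : open U -> (forall x, U x -> f x = g x) ->
  Ck k U f -> Ck k U g.
Proof.
move=> oU; elim: k f g => [|k IH] f g fg Cf.
all: have fgn x : U x -> \near x, f x = g x
  by move=> Ux; apply: filterS (open_nbhs_nbhs (conj oU Ux)).
all: have cg x : U x -> {for x, continuous g}
  by move=> Ux; rewrite /prop_for /continuous_at -fg //;
     apply: cvg_trans (Ck_cont Cf Ux);
     exact: (@near_eq_cvg _ _ (nbhs x) _ f g (fgn x Ux)).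
  by split.
case: Cf => [_ df]; split=> // i.
have [dfi Cdf] := df i; split=> [x Ux|].
  by apply: near_eq_derivable (dfi x Ux); exact: fgn.
apply: IH Cdf => x Ux; rewrite /partial.
by apply: near_eq_derive; exact: fgn.
Qed.

Lemma CkW k U f : Ck k.+1 U f -> Ck k U f.
Proof.
elim: k f => [|k IH] f [cf df]; split=> // i.
by have [dfi Cf] := df i; split=> //; exact: IH.
Qed.

Lemma Ck_cst k U (c : R) : Ck k U (cst c).
Proof.
elim: k c => [|k IH] c; split=> //; try by move=> x _; exact: cst_continuous.
move=> i; split=> [x _|]; first exact: derivable_cst.
suff -> : partial i (cst c) = cst 0 by exact: IH.
by apply/funext => x; rewrite /partial derive_cst.
Qed.

Lemma CkD k U f g : open U -> Ck k U f -> Ck k U g -> Ck k U (f + g).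
Proof.
move=> oU; elim: k f g => [|k IH] f g [cf df] [cg dg].
  by split=> // x Ux; apply: continuousD; [exact: cf|exact: cg].
split=> [x Ux|i]; first by apply: continuousD; [exact: cf|exact: cg].
have [dfi Cf] := df i; have [dgi Cg] := dg i.
split=> [x Ux|]; first by apply: derivableD; [exact: dfi|exact: dgi].
apply: Ck_eq (IH _ _ Cf Cg) => // x Ux.
by rewrite /partial deriveD //; [exact: dfi|exact: dgi].
Qed.

Lemma CkM k U f g : open U -> Ck k U f -> Ck k U g -> Ck k U (f * g).
Proof.
move=> oU; elim: k f g => [|k IH] f g.
  move=> [cf _] [cg _]; split=> // x Ux.
  by apply: continuousM; [exact: cf|exact: cg].
move=> Ckf Ckg; have Wf := CkW Ckf; have Wg := CkW Ckg.
case: Ckf Ckg => [cf df] [cg dg].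
split=> [x Ux|i]; first by apply: continuousM; [exact: cf|exact: cg].
have [dfi Cf] := df i; have [dgi Cg] := dg i.
split=> [x Ux|]; first by apply: derivableM; [exact: dfi|exact: dgi].
apply: Ck_eq (CkD oU (IH _ _ Wf Cg) (IH _ _ Wg Cf)) => // x Ux.
by rewrite /partial deriveM //; [exact: dfi|exact: dgi].
Qed.

End SmoothFunctions.

Record chart (R : realType) (n : nat) (T : topologicalType) := Chart {
  cdom : set T;
  coord : T -> 'rV[R]_n;
  param : 'rV[R]_n -> T;
  cdom_open : open cdom;
  cimage_open : open (coord @` cdom);
  coordK : forall p, cdom p -> param (coord p) = p;
  coord_continuous : forall p, cdom p -> {for p, continuous coord};
  param_continuous :
    forall u, (coord @` cdom) u -> {for u, continuous param}
}.

Arguments cdom_open {R n T} c.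
Arguments cimage_open {R n T} c.

(* The atlas need not be maximal: replacing it by the maximal atlas containing
   it changes neither the smooth functions nor any notion built on them. *)
Record smoothManifold (R : realType) (n : nat) := SmoothManifold {
  space :> topologicalType;
  atlas : set (chart R n space);
  space_hausdorff : hausdorff_space space;
  space_second_countable : @second_countable space;
  atlas_cover : forall p : space, exists2 c, atlas c & cdom c p;
  atlas_compat : forall c d, atlas c -> atlas d ->
    forall i : 'I_n,
      smooth_on (coord c @` (cdom c `&` cdom d))
                (fun u => coord d (param c u) 0 i)
}.

Section SmoothRing.
Context {R : realType} {n : nat} (M : smoothManifold R n).

Definition smooth_fct (f : M -> R) : Prop :=
  forall c, atlas c -> smooth_on (coord c @` cdom c) (f \o param c).

Definition smooth_pred : {pred M -> R} := fun f => `[< smooth_fct f >].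

Lemma smooth_subring : subring_closed smooth_pred.
Proof.
split=> [|f g /asboolP sf /asboolP sg|f g /asboolP sf /asboolP sg];
  apply/asboolP => c Ac k.
- exact: Ck_cst.
- have oU := cimage_open c.
  apply: (@Ck_eq _ _ k _ ((f \o param c) + cst (-1) * (g \o param c))) => //.
    by move=> x _ /=; rewrite !fctE mulN1r.
  apply: CkD (sf c Ac k) _ => //.
  exact: CkM (Ck_cst _ _ _) (sg c Ac k).
- have oU := cimage_open c.
  exact: (CkM oU (sf c Ac k) (sg c Ac k)).
Qed.

HB.instance Definition _ :=
  GRing.isSubringClosed.Build (M -> R) smooth_pred smooth_subring.

Record Cinf := MkCinf { cinf_fun :> M -> R; _ : cinf_fun \in smooth_pred }.

HB.instance Definition _ := [isSub for cinf_fun].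
HB.instance Definition _ := [Choice of Cinf by <:].
HB.instance Definition _ := 
  GRing.SubChoice_isSubComPzRing.Build _ _ Cinf (subringClosedP _).

Lemma cst_smooth (a : R) : (cst a : M -> R) \in smooth_pred.
Proof. by apply/asboolP => c _ k; exact: Ck_cst. Qed.

Definition cinf_cst (a : R) : Cinf := MkCinf (cst_smooth a).

End SmoothRing.

Arguments smooth_pred {R n} M.

Section TangentSpace.
Context {R : realType} {n : nat} {M : smoothManifold R n}.
Local Notation C := (Cinf M).

Definition derivation_at (p : M) (v : C -> R) : Prop :=
  [/\ forall f g, v (f + g) = v f + v g,
      forall a f, v (cinf_cst M a * f) = a * v f &
      forall f g, v (f * g) = f p * v g + g p * v f].

Definition tangent_pred (p : M) : {pred C -> R^o} :=
  fun v => `[< derivation_at p v >].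

Lemma tangent_submod p : subsemimod_closed (tangent_pred p).
Proof.
split.
  split.
    apply/asboolP; split=> [f g|a f|f g].
    + by rewrite -[RHS]/(0 + 0 : R) addr0.
    + by rewrite -[RHS]/(a * 0 : R) mulr0.
    + by rewrite -[RHS]/(f p * 0 + g p * 0 : R) !mulr0 addr0.
  move=> v w /asboolP [vD vZ vM] /asboolP [wD wZ wM].
  apply/asboolP; split=> [f g|a f|f g]; rewrite !addrfctE.
  - by rewrite vD wD addrACA.
  - by rewrite vZ wZ mulrDr.
  - by rewrite vM wM !mulrDr addrACA.
move=> b v /asboolP [vD vZ vM].
apply/asboolP; split=> [f g|a f|f g]; rewrite !scalrfctE.
- by rewrite vD scalerDr.
- by rewrite vZ /GRing.scale /= mulrCA.
- by rewrite vM /GRing.scale /= mulrDr mulrCA [X in _ + X]mulrCA.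
Qed.

HB.instance Definition _ p := GRing.isSubmodClosed.Build R (C -> R^o)
  (tangent_pred p) (tangent_submod p).

Record tangent (p : M) := Tangent {
  tangent_fun :> C -> R^o;
  _ : tangent_fun \in tangent_pred p }.

HB.instance Definition _ p := [isSub for @tangent_fun p].
HB.instance Definition _ p := [Choice of tangent p by <:].
HB.instance Definition _ p := [SubChoice_isSubLmodule of tangent p by <:].

(* Smooth vector fields, as derivations of the R-algebra of smooth functions. *)
Definition derivation (X : C -> C) : Prop :=
  [/\ forall f g, X (f + g) = X f + X g,
      forall a f, X (cinf_cst M a * f) = cinf_cst M a * X f &
      forall f g, X (f * g) = f * X g + g * X f].

Definition vfield_pred : {pred C -> C^o} := fun X => `[< derivation X >].

Lemma vfield_submod : subsemimod_closed vfield_pred.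
Proof.
split.
  split.
    apply/asboolP; split=> [f g|a f|f g].
    + by rewrite -[RHS]/(0 + 0 : C) addr0.
    + by rewrite -[RHS]/(cinf_cst M a * 0 : C) mulr0.
    + by rewrite -[RHS]/(f * 0 + g * 0 : C) !mulr0 addr0.
  move=> v w /asboolP [vD vZ vM] /asboolP [wD wZ wM].
  apply/asboolP; split=> [f g|a f|f g]; rewrite !addrfctE.
  - by rewrite vD wD addrACA.
  - by rewrite vZ wZ mulrDr.
  - by rewrite vM wM !mulrDr addrACA.
move=> b v /asboolP [vD vZ vM].
apply/asboolP; split=> [f g|a f|f g]; rewrite !scalrfctE.
- by rewrite vD scalerDr.
- by rewrite vZ /GRing.scale /= mulrCA.
- by rewrite vM /GRing.scale /= mulrDr mulrCA [X in _ + X]mulrCA.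
Qed.

HB.instance Definition _ := GRing.isSubmodClosed.Build C (C -> C^o)
  vfield_pred vfield_submod.

Record vfield := VField {
  vfield_fun :> C -> C^o;
  _ : vfield_fun \in vfield_pred }.

HB.instance Definition _ := [isSub for vfield_fun].
HB.instance Definition _ := [Choice of vfield by <:].
HB.instance Definition _ := [SubChoice_isSubLmodule of vfield by <:].

Lemma vfield_derivation (X : vfield) : derivation X.
Proof. by case: X => X hX; apply/asboolP. Qed.

Lemma lie_subproof (X Y : vfield) :
  (fun f => X (Y f) - Y (X f) : C^o) \in vfield_pred.
Proof.
have [XD XZ XM] := vfield_derivation X.
have [YD YZ YM] := vfield_derivation Y.
apply/asboolP; split=> [f g|a f|f g].
- by rewrite YD XD XD YD opprD addrACA.
- by rewrite YZ XZ XZ YZ mulrBr.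
- rewrite YM XM XD !XM YD !YM; ring.
Qed.

Definition lie (X Y : vfield) : vfield := VField (lie_subproof X Y).

Lemma value_subproof (p : M) (X : vfield) :
  (fun f => X f p : R^o) \in tangent_pred p.
Proof.
have [XD XZ XM] := vfield_derivation X.
by apply/asboolP; split=> [f g|a f|f g]; rewrite ?XD ?XZ ?XM.
Qed.

Definition value (p : M) (X : vfield) : tangent p :=
  Tangent (value_subproof p X).

(* Every tangent vector is the value of some vector field, so the default [0]
   is never used. *)
Definition extension (p : M) (v : tangent p) : vfield :=
  xget 0 [set X | value p X = v].

End TangentSpace.

Arguments vfield {R n} M.

Definition bilin (R : realType) (V : lmodType R) (b : V -> V -> R) : Prop :=
  (forall y, scalar (b^~ y)) /\ (forall x, scalar (b x)).

(* No condition on the index is imposed: the signature is arbitrary. *)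
Record metric (R : realType) (n : nat) (M : smoothManifold R n) := Metric {
  metric_at :> forall p : M, tangent p -> tangent p -> R;
  metric_bilin : forall p, bilin (@metric_at p);
  metric_sym : forall p (v w : tangent p), metric_at v w = metric_at w v;
  metric_nondeg : forall p (v : tangent p),
    (forall w, metric_at v w = 0) -> v = 0;
  metric_smooth : forall X Y : vfield M,
    (fun p => metric_at (value p X) (value p Y)) \in smooth_pred M
}.

Arguments metric_at {R n M} m p _ _.

Record oneForm (R : realType) (n : nat) (M : smoothManifold R n) := OneForm {
  form_at :> forall p : M, tangent p -> R;
  form_linear : forall p, scalar (@form_at p);
  form_smooth : forall X : vfield M,
    (fun p => form_at (value p X)) \in smooth_pred M
}.

Arguments form_at {R n M} o p _.

Record connection (R : realType) (n : nat) (M : smoothManifold R n) :=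
  Connection {
  nabla :> vfield M -> vfield M -> vfield M;
  nablaDl : forall X X' Y, nabla (X + X') Y = nabla X Y + nabla X' Y;
  nablaZl : forall (f : Cinf M) X Y, nabla (f *: X) Y = f *: nabla X Y;
  nablaDr : forall X Y Y', nabla X (Y + Y') = nabla X Y + nabla X Y';
  nablaZr : forall (f : Cinf M) X Y,
    nabla X (f *: Y) = (X f : Cinf M) *: Y + f *: nabla X Y
}.

Section WeylManifold.
Context {R : realType} {n : nat} {M : smoothManifold R n}.
Implicit Types (g : metric M) (D : connection M) (X Y Z : vfield M).

Definition torsion_free D : Prop := forall X Y, D X Y - D Y X = lie X Y.

Definition metric_cinf g X Y : Cinf M := MkCinf (metric_smooth g X Y).

(* The covariant derivative (nabla_X g)(Y, Z). *)
Definition nabla_metric D g X Y Z : Cinf M :=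
  X (metric_cinf g Y Z) - metric_cinf g (D X Y) Z - metric_cinf g Y (D X Z).

Definition weyl g D : Prop :=
  torsion_free D /\
  exists phi : oneForm M, forall X Y Z (p : M),
    nabla_metric D g X Y Z p =
      - 2 * phi p (value p X) * g p (value p Y) (value p Z).

Definition curv_field D X Y Z : vfield M :=
  D X (D Y Z) - D Y (D X Z) - D (lie X Y) Z.

(* The curvature operator on tangent vectors; [curv_field] is tensorial, so the
   choice of the extensions is immaterial. *)
Definition curv_op D (p : M) (x y z : tangent p) : tangent p :=
  value p (curv_field D (extension x) (extension y) (extension z)).

Definition curv g D (p : M) (x y z w : tangent p) : R :=
  g p (curv_op D x y z) w.

End WeylManifold.

Arguments curv {R n M} g D p x y z w.

Section Tensors.
Context {R : realType} {V : lmodType R}.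
Local Notation form2 := (V -> V -> R).
Local Notation form4 := (V -> V -> V -> V -> R).
Implicit Types (b c : form2) (A B : form4).

Definition symm b : form2 := fun x y => (b x y + b y x) / 2.
Definition asymm b : form2 := fun x y => (b x y - b y x) / 2.

Definition tdot b c : form4 := fun x y z w => b x y * c z w.

Definition twedge (r : int) b c : form4 := fun x y z w =>
  b x z * c y w - b y z * c x w - r%:~R * (b x w * c y z - b y w * c x z).

Definition conj_tensor A : form4 := fun x y w z => - A x y z w.

Definition multilinear4 A : Prop :=
  [/\ forall y z w, scalar (fun x => A x y z w),
      forall x z w, scalar (fun y => A x y z w),
      forall x y w, scalar (fun z => A x y z w) &
      forall x y z, scalar (A x y z)].

Definition is_basis (n : nat) (e : 'I_n -> V) : Prop :=
  forall v, exists! a : 'rV[R]_n, v = \sum_(i < n) a 0 i *: e i.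

Section Metric.
Variables (n : nat) (g : form2).

Definition some_basis : 'I_n -> V := xget (fun=> 0) [set e | is_basis e].

(* The coefficients g^{ij}; contractions with them do not depend on the basis
   used. *)
Definition inv_metric : 'M[R]_n :=
  invmx (\matrix_(i, j) g (some_basis i) (some_basis j)).

Definition contract b : R :=
  \sum_(i < n) \sum_(j < n) inv_metric i j * b (some_basis i) (some_basis j).

Definition Ric A : form2 := fun x y => contract (fun u v => A u x y v).

Definition scal A : R := contract (Ric A).

Definition length_curv A : form2 := fun x y => - (2 / n%:R) * asymm (Ric A) x y.

Definition alpha1 A : form4 := fun x y z w =>
  - (1 / (n%:R * (n%:R - 1))) * scal A * twedge 0 g g x y z w.

Definition alpha2 A : form4 := fun x y z w =>
  - (1 / (n%:R - 2)) * twedge 1 (symm (Ric A)) g x y z w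
  + 2 / (n%:R * (n%:R - 2)) * scal A * twedge 0 g g x y z w.

Definition alpha6 A : form4 := fun x y z w =>
  A x y z w + 2 / n%:R * tdot (asymm (Ric A)) g x y z w
  + 1 / n%:R * twedge 1 (asymm (Ric A)) g x y z w
  + 1 / (n%:R - 2) * twedge 1 (symm (Ric A)) g x y z w
  - 1 / ((n%:R - 1) * (n%:R - 2)) * scal A * twedge 0 g g x y z w.

Definition spaceW : set form4 := [set A |
  [/\ multilinear4 A,
      forall x y z w, A x y z w = - A y x z w,
      forall x y z w, A x y z w + A y z x w + A z x y w = 0 &
      forall x y z w, A x y z w + A x y w z =
        - (4 / n%:R) * asymm (Ric A) x y * g z w]].

Definition spaceA : set form4 := [set A |
  spaceW A /\ forall x y z w, A x y z w + A x y w z = 0].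

Definition spaceP : set form4 := [set A |
  exists b, [/\ bilin b, forall x y, b x y = - b y x &
    A = fun x y z w => 2 * tdot b g x y z w + twedge 1 b g x y z w]].

(* The projection on [spaceP] along [spaceA]; [spaceW] is the direct sum of the
   two, so for [A] in [spaceW] there is exactly one such [B]. *)
Definition higa A : form4 :=
  xget (fun _ _ _ _ => 0)
    [set B | spaceP B /\ spaceA (fun x y z w => A x y z w - B x y z w)].

End Metric.
End Tensors.

Section DirectionalCurvature.
Context {R : realType} {n : nat} {M : smoothManifold R n}.
Variables (g : metric M) (D : connection M) (p : M).

Definition length_curv_op (x y z : tangent p) : tangent p :=
  length_curv n (g p) (curv g D p) x y *: z.

Definition dir_curv_op (x y z : tangent p) : tangent p :=
  curv_op D x y z - length_curv_op x y z.

End DirectionalCurvature.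

(* Main.v *)
Require Import Defs.
From mathcomp Require Import all_boot all_order all_algebra.
From mathcomp Require Import ring lra.
From mathcomp Require Import all_classical all_reals all_analysis.
Import Order.TTheory GRing.Theory Num.Theory.
Import numFieldNormedType.Exports.

Set Implicit Arguments.
Unset Strict Implicit.
Unset Printing Implicit Defensive.

Local Open Scope classical_set_scope.
Local Open Scope ring_scope.

(** At a single point the statement is linear algebra.  The curvature tensor
    R is 4-linear, skew in its first two arguments and satisfies the first
    Bianchi identity, and differentiating nabla g = -2 phi.g once more gives
      R(x,y,z,w) + R(x,y,w,z) = c(x,y) g(z,w)
    for some function c ([weyl_curv]).  Contracting the Bianchi identity in
    its first and last slots identifies c: the anti-symmetrized Ricci tensor
    is -(n/4) c ([asymm_Ric]), which says that half of the left hand side is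
    the length curvature.  A tensor 2 b.g + b /\_1 g has 4 b.g as the same
    symmetrization in z, w, so the only candidate for H(R) is the one with
    b = c/4, and subtracting it from R does land in the complementary space
    because its Ricci tensor is - n b ([higaE]).  The four equalities are
    then identities of rational functions of n: in alpha_1 + alpha_2 + alpha_6
    the symmetrized Ricci and scalar curvature terms cancel.

    Two facts behind this picture belong to differential geometry.  The
    contractions run over bases of n elements, so tangent spaces, which are
    spaces of derivations of the ring of smooth functions, must have
    dimension n; and the curvature operator extends tangent vectors to vector
    fields, so it is 4-linear only if the result does not depend on the
    extensions.  Both follow from [local_frame]: around p there are smooth
    functions rho, X_i and vector fields D_i, with rho(p) nonzero, such that
    rho(q) v = sum_i v(X_i) D_i(q) for all tangent vectors v at all points q.
    Read at p this produces a basis and extensions of all vectors at p; read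
    on vector fields it shows that an operator linear over smooth functions
    sees only the value at p of its argument ([tensorial]).

    The local frame rests on the Hadamard lemma: on a star-shaped domain a
    smooth F is F(z) + sum_i (u_i - z_i) g_i(u) with g_i smooth, so that
    a derivation at z sends F to sum_i g_i(z) v(u_i).  Two nested cutoff
    functions, built from the flat function exp(-1/s), transport this from a
    chart to the manifold. *)

(** * Functions of class C^k and the chain rule *)

Section CkBasics.
Context {R : realType} {n : nat}.
Local Notation E := 'rV[R]_n.
Implicit Types (U V : set E) (f g : E -> R).

(** The condition defining C^k constrains f and its partial derivatives point by
    point, so it can be checked on any sets covering U. *)
Lemma Ck_local k U f :
  (forall x, U x -> exists2 V, V x & Ck k V f) -> Ck k U f.
Proof.
elim: k f => [|k IH] f H; split=> //.
1,2: by move=> x /H [V Vx /Ck_cont]; exact.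
move=> i; split=> [x /H [V Vx [_ /(_ i) [+ _]]]|]; first exact.
by apply: IH => x /H [V Vx [_ /(_ i) [_ ?]]]; exists V.
Qed.

Lemma Ck_sub k U V f : U `<=` V -> Ck k V f -> Ck k U f.
Proof. by move=> UV CV; apply: Ck_local => x /UV; exists V. Qed.

Lemma Ck_le k m U f : (k <= m)%N -> Ck m U f -> Ck k U f.
Proof.
elim: m => [|m IH]; first by rewrite leqn0 => /eqP ->.
by rewrite leq_eqVlt => /predU1P[->//|/IH IH' /CkW]; exact: IH'.
Qed.

Lemma Ck_sum k U m (F : 'I_m -> E -> R) :
  open U -> (forall i, Ck k U (F i)) -> Ck k U (\sum_(i < m) F i).
Proof.
move=> oU HF; elim/big_ind: _ => [|f g|i _]; [exact: Ck_cst|exact: CkD|exact: HF].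
Qed.

Lemma Ck_prod k U m (F : 'I_m -> E -> R) :
  open U -> (forall i, Ck k U (F i)) -> Ck k U (\prod_(i < m) F i).
Proof.
move=> oU HF; elim/big_ind: _ => [|f g|i _]; [exact: Ck_cst|exact: CkM|exact: HF].
Qed.

Lemma is_derive_coord i j (x : E) :
  is_derive x (delta_mx 0 j) (fun u : E => u 0 i) ((i == j)%:R).
Proof.
have H : (fun h : R => h^-1 *: (((fun u : E => u 0 i) \o shift x)
    (h *: delta_mx 0 j) - x 0 i)) @ 0^' --> ((i == j)%:R : R).
  apply: cvg_near_cst; near=> h => /=.
  rewrite !mxE addrK eqxx /= /GRing.scale /= mulKf //.
  by near: h; exact: nbhs_dnbhs_neq.
by apply: DeriveDef; [apply/cvg_ex; exists ((i == j)%:R)|exact: cvg_lim H].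
Unshelve. all: by end_near. Qed.

Lemma Ck_coord k U i : Ck k U (fun u => u 0 i).
Proof.
case: k => [|k]; split=> //; try by move=> x _; exact: coord_continuous.
move=> j; split=> [x _|]; first by have [] := is_derive_coord i j x.
have -> : partial j (fun u : E => u 0 i) = (cst ((i == j)%:R : R) : E -> R).
  by apply/funext => x; have [_] := is_derive_coord i j x.
exact: Ck_cst.
Qed.

Lemma CkV k U f : open U -> (forall x, U x -> f x != 0) -> Ck k U f ->
  Ck k U (fun x => (f x)^-1).
Proof.
move=> oU; elim: k f => [|k IH] f f0 Cf.
  by split=> // x Ux; apply: continuousV; [exact: f0|exact: Ck_cont Cf _ Ux].
have Wf := CkW Cf; case: Cf => [cf df].
split=> [x Ux|i]; first by apply: continuousV; [exact: f0|exact: cf].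
have [dfi Cf] := df i; split=> [x Ux|].
  by apply: derivableV; [exact: f0|exact: dfi].
have CV := IH _ f0 Wf.
apply: (@Ck_eq _ _ k U (cst (-1) * ((fun x => (f x)^-1) * (fun x => (f x)^-1))
   * partial i f)) => //.
  move=> x Ux; rewrite /partial deriveV ?f0 //; last exact: dfi.
  rewrite !fctE /GRing.scale /= -exprVn expr2; ring.
by apply: CkM => //; apply: CkM => //; [exact: Ck_cst|exact: CkM].
Qed.

End CkBasics.

Section ChainRule.
Context {R : realType}.

Lemma is_derive_line (V : normedModType R) (f : V -> R) (y e : V) (s : R) :
  derivable f (s *: e + y) e ->
  is_derive s 1 (fun t : R => f (t *: e + y)) ('D_e f (s *: e + y)).
Proof.
move=> df.
have E : (fun h : R => h^-1 *: (((fun t : R => f (t *: e + y)) \o shift s)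
   (h *: (1 : R)) - f (s *: e + y))) =
  (fun h : R => h^-1 *: ((f \o shift (s *: e + y)) (h *: e) - f (s *: e + y))).
  apply/funext => h /=; congr (_ *: (f _ - _)).
  by rewrite [h *: 1]mulr1 scalerDl addrA.
by apply: DeriveDef; [rewrite /derivable E|rewrite /derive E].
Qed.

(** Bounding c by |h| covers both signs of h at once. *)
Lemma MVT_from0 (f df : R -> R) (h : R) :
  (forall s : R, `|s| <= `|h| -> is_derive s 1 f (df s)) ->
  exists2 c, `|c| <= `|h| & f h - f 0 = h * df c.
Proof.
move=> D.
have C (s : R) : `|s| <= `|h| -> {for s, continuous f}.
  by move=> /D [d _]; apply: differentiable_continuous; exact/derivable1_diffP.
have [h0|h0] := leP 0 h.
  have H : forall s, s \in `[0, h] -> `|s| <= `|h|.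
    by move=> s; rewrite in_itv /= => /andP[a b]; rewrite !ger0_norm.
  have [||c cI ->] := @MVT_segment R f df 0 h h0.
  - by move=> x xI; apply: D; apply: H; move: xI; exact: subset_itv_oo_cc.
  - by apply: continuous_in_subspaceT => x /set_mem xI; apply: C; exact: H.
  by exists c; [exact: H|rewrite subr0 mulrC].
have H : forall s, s \in `[h, 0] -> `|s| <= `|h|.
  by move=> s; rewrite in_itv /= => /andP[a b]; rewrite !ler0_norm ?lerN2 // ltW.
have [||c cI E] := @MVT_segment R f df h 0 (ltW h0).
- by move=> x xI; apply: D; apply: H; move: xI; exact: subset_itv_oo_cc.
- by apply: continuous_in_subspaceT => x /set_mem xI; apply: C; exact: H.
by exists c; [exact: H|rewrite -opprB E; ring].
Qed.

Context {n : nat}.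
Local Notation E := 'rV[R]_n.

(** The staircase from x to u: after k steps the first k coordinates are those
    of u, and two consecutive corners differ in one coordinate only. *)
Definition stair (x u : E) (k : nat) : E :=
  \row_(i < n) if (i < k)%N then u 0 i else x 0 i.

Lemma stair0 x u : stair x u 0 = x.
Proof. by apply/rowP => i; rewrite mxE. Qed.

Lemma stair_full x u : stair x u n = u.
Proof. by apply/rowP => i; rewrite mxE ltn_ord. Qed.

Lemma stairS x u (j : 'I_n) :
  stair x u j.+1 = (u 0 j - x 0 j) *: delta_mx 0 j + stair x u j.
Proof.
apply/rowP => i; rewrite !mxE eqxx /= ltnS leq_eqVlt -val_eqE /=.
case: eqP => [/val_inj ->|_] /=; last by rewrite mulr0 add0r.
by rewrite ltnn mulr1 subrK.
Qed.

Lemma ball_row (x u : E) e :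
  ball x e u <-> 0 < e /\ forall i, `|x 0 i - u 0 i| < e.
Proof.
split=> [[e0 H]|[e0 H]]; split=> // i.
  exact: H.
by move=> j; rewrite ord1; exact: H.
Qed.

(** Difference quotient of f along one step of the staircase, completed by the
    partial derivative when that step has length zero. *)
Definition slope (f : E -> R) (x : E) (j : 'I_n) (u : E) : R :=
  if u 0 j == x 0 j then partial j f x
  else (f (stair x u j.+1) - f (stair x u j)) / (u 0 j - x 0 j).

(** The increment of f telescopes along the staircase. *)
Lemma slope_sum (f : E -> R) x u :
  f u - f x = \sum_(j < n) (u 0 j - x 0 j) * slope f x j u.
Proof.
have H := telescope_sumr (fun k => f (stair x u k)) (leq0n n).
rewrite /= stair0 stair_full big_mkord in H; rewrite -H.
apply: eq_bigr => j _; rewrite /slope; case: eqP => [e|/eqP ne].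
  by rewrite stairS e subrr scale0r add0r subrr mul0r.
by rewrite mulrC divfK // subr_eq0.
Qed.

(** By the mean value theorem the slope is a value of the partial derivative at a
    point of the step, and this derivative is continuous at x. *)
Lemma slope_cvg (U : set E) (f : E -> R) x j : open U -> U x -> Ck 1 U f ->
  slope f x j @ nbhs x --> partial j f x.
Proof.
move=> oU Ux [_ /(_ j) [df [cdf _]]].
apply/cvgrPdist_lt => eps eps0.
have /nbhs_ballP [d /= d0 dU] : nbhs x U by apply: open_nbhs_nbhs.
have /cvgrPdist_lt /(_ _ eps0) /nbhs_ballP [d' /= d'0 dC] := cdf _ Ux.
apply/nbhs_ballP; exists (Num.min d d') => /=; first by rewrite lt_min d0.
move=> u /ball_row[_ xu]; rewrite /slope; case: eqP => [_|/eqP ne].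
  by rewrite subrr normr0.
have B (s : R) : `|s| <= `|u 0 j - x 0 j| ->
    ball x (Num.min d d') (s *: delta_mx 0 j + stair x u j).
  move=> Hs; apply/ball_row; split=> [|i]; first by rewrite lt_min d0.
  rewrite !mxE eqxx /=; case: eqP => [->|_] /=.
    rewrite ltnn mulr1 addrC opprD addNKr normrN.
    by apply: le_lt_trans Hs _; rewrite distrC.
  by rewrite mulr0 add0r; case: ifP; rewrite // subrr normr0 lt_min d0.
have BU s : `|s| <= `|u 0 j - x 0 j| -> U (s *: delta_mx 0 j + stair x u j).
  by move=> /B Bs; apply: dU; apply: le_ball Bs; rewrite ge_min lexx.
have [|c cle] := @MVT_from0 (fun s => f (s *: delta_mx 0 j + stair x u j))
   (fun s => partial j f (s *: delta_mx 0 j + stair x u j)) (u 0 j - x 0 j).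
  by move=> s sle; apply: is_derive_line; apply: df; exact: BU.
rewrite -stairS scale0r add0r => ->.
rewrite mulrAC divff ?subr_eq0 // mul1r; apply: dC.
by apply: le_ball (B _ cle); rewrite ge_min lexx orbT.
Qed.

(** The outer function is only known to have continuous partial derivatives, and
    the inner one to be derivable along v: dividing [slope_sum] by h gives the
    formula without going through total differentials. *)
Lemma chain_rule (V : normedModType R) (U : set E) (f : E -> R)
    (c : V -> E) (a v : V) : open U -> U (c a) -> Ck 1 U f ->
  (forall i, derivable (fun t => c t 0 i) a v) ->
  is_derive a v (f \o c)
    (\sum_(j < n) partial j f (c a) * 'D_v (fun t => c t 0 j) a).
Proof.
move=> oU Ua Cf dc.
have cc : c (h *: v + a) @[h --> (0:R)^'] --> c a.
  have dC : derivable c a v.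
    by apply/derivable_mxP => i j; rewrite ord1; exact: dc.
  have /derivable1P/derivable1_diffP/differentiable_continuous := dC.
  by move=> /continuous_withinNx; rewrite scale0r add0r.
have H : (fun h : R => h^-1 *: (((f \o c) \o shift a) (h *: v) - (f \o c) a))
   @ 0^' --> \sum_(j < n) partial j f (c a) * 'D_v (fun t => c t 0 j) a.
  have -> : (fun h : R => h^-1 *: (((f \o c) \o shift a) (h *: v) - (f \o c) a))
    = \sum_(j < n) (fun h : R => slope f (c a) j (c (h *: v + a)) *
      (h^-1 *: (((fun t => c t 0 j) \o shift a) (h *: v) - c a 0 j))).
    apply/funext => h; rewrite fct_sumE /= slope_sum scaler_sumr.
    by apply: eq_bigr => j _; rewrite /GRing.scale /=; ring.
  elim/big_ind2: _ => [|f1 f2 g1 g2|j _]; [exact: cvg_cst|exact: cvgD|].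
  apply: cvgM; last exact: dc.
  exact: (cvg_comp _ _ cc (slope_cvg oU Ua Cf)).
by apply: DeriveDef; [apply/cvg_ex; eexists; exact: H|exact: cvg_lim H].
Qed.

End ChainRule.

Section CkComp.
Context {R : realType} {n m : nat}.

Lemma Ck_comp k (U : set 'rV[R]_n) (W : set 'rV[R]_m)
    (f : 'rV[R]_m -> R) (c : 'rV[R]_n -> 'rV[R]_m) :
  open U -> open W -> (forall x, U x -> W (c x)) ->
  Ck k W f -> (forall j, Ck k U (fun x => c x 0 j)) -> Ck k U (f \o c).
Proof.
move=> oU oW cUW.
have cont f' k' : Ck k' W f' -> (forall j, Ck k' U (fun x => c x 0 j)) ->
    forall x, U x -> {for x, continuous (f' \o c)}.
  move=> Cf Cc x Ux; apply: continuous_comp; last exact: Ck_cont Cf _ (cUW _ Ux).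
  have FF : Filter (nbhs x) by exact: nbhs_filter.
  apply/(@cvgrPdist_lt _ _ _ (nbhs x)) => eps eps0.
  near=> t.
  suff : ball (c x) eps (c t) by rewrite mx_norm_ball.
  apply/ball_row; split=> //.
  near: t; apply: filter_forall => i.
  by have /cvgrPdist_lt := Ck_cont (Cc i) Ux; exact.
elim: k f => [|k IH] f Cf Cc; first by split=> //; exact: cont Cf Cc.
split; first exact: cont Cf Cc.
move=> i.
have CR x : U x -> is_derive x (delta_mx 0 i) (f \o c)
    (\sum_(j < m) partial j f (c x) * partial i (fun t => c t 0 j) x).
  move=> Ux; apply: (chain_rule (U := W)) => //; first exact: cUW.
    exact: Ck_le Cf.
  by move=> j; have [_ /(_ i) [+ _]] := Cc j; exact.
split=> [x /CR []//|].
apply: (@Ck_eq _ _ k U (\sum_(j < m) (partial j f \o c) *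
    partial i (fun t => c t 0 j))) => //.
  by move=> x /CR [_ H]; rewrite /partial H fct_sumE.
apply: Ck_sum => // j; apply: CkM => //.
  apply: IH; first by have [_ /(_ j) []] := Cf.
  by move=> l; exact: CkW.
by have [_ /(_ i) []] := Cc j.
Unshelve. all: by end_near. Qed.

End CkComp.

(** * Flat functions and cutoffs *)

Section Flat.
Context {R : realType}.
Implicit Types (q : {poly R}) (s : R).

(** The functions q(1/s) exp(-1/s) for s > 0, continued by 0: this family is
    stable under derivation, so its members are smooth. *)
Definition flat q s : R := if 0 < s then q.[s^-1] * expR (- s^-1) else 0.

Lemma horner_bound q (y : R) : 1 <= y ->
  `|q.[y]| <= (\sum_(i < size q) `|q`_i|) * y ^+ size q.
Proof.
move=> y1; rewrite horner_coef mulr_suml.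
apply: (le_trans (ler_norm_sum _ _ _)); apply: ler_sum => i _.
rewrite normrM ler_wpM2l // normrX ger0_norm; last exact: le_trans y1.
by rewrite ler_weXn2l // ltnW.
Qed.

(** The exponential dominates y^(d+2) with d the length of q and y = 1/s; the two
    extra powers leave a quadratic bound, hence a zero derivative at 0. *)
Lemma flat_bound q : exists2 K, 0 <= K &
  forall s, `|s| <= 1 -> `|flat q s| <= K * s ^+ 2.
Proof.
set C := \sum_(i < size q) `|q`_i|; set d := size q.
have C0 : 0 <= C by apply: sumr_ge0.
exists (C * (d.+2)`!%:R); first by rewrite mulr_ge0.
move=> s; rewrite /flat; case: ifP => [s0|_ _]; last first.
  by rewrite normr0 mulr_ge0 ?sqr_ge0 // mulr_ge0.
rewrite (ger0_norm (ltW s0)) => s1.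
set y := s^-1; have y0 : 0 < y by rewrite invr_gt0.
have y1 : 1 <= y by rewrite invf_ge1.
have F0 : 0 < (d.+2)`!%:R :> R by rewrite ltr0n fact_gt0.
have L : y ^+ d.+2 <= (d.+2)`!%:R * expR y.
  rewrite mulrC -ler_pdivrMr //.
  by have := expR_ge1Dxn d.+1 (ltW y0); apply: le_trans; rewrite lerDr.
have -> : s ^+ 2 = y ^- 2 by rewrite /y exprVn invrK.
rewrite normrM (ger0_norm (expR_ge0 _)) expRN ler_pdivrMr ?expR_gt0 //.
apply: (le_trans (horner_bound _ y1)); rewrite -/C -/d.
rewrite -!mulrA ler_wpM2l // mulrCA ler_pdivlMl ?exprn_gt0 //.
by rewrite -exprD.
Qed.

Definition dflat q : {poly R} := 'X^2 * (q - q^`()).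

Lemma is_derive_flat q s : is_derive s 1 (flat q) (flat (dflat q) s).
Proof.
case: (ltgtP s 0) => [s0|s0|->].
- have -> : flat (dflat q) s = 0 by rewrite /flat ltNge ltW.
  apply: (near_eq_is_derive (f := cst 0)).
  near=> t; rewrite /flat ifF //; apply/negbTE; rewrite -leNgt ltW //.
  by near: t; exact: lt_nbhsl.
- have sn0 : s != 0 by rewrite gt_eqF.
  have dI : is_derive s 1 (fun t : R => t^-1) (- s ^- 2).
    by apply: DeriveDef; [exact: (@derivableV _ _ id)|
      rewrite (@deriveV _ _ id) // derive_id [_ *: _]mulr1].
  have dE : is_derive s 1 (fun t : R => expR (- t^-1)) (expR (- s^-1) * s ^- 2).
    have dN : is_derive s 1 (fun t : R => - t^-1) (s ^- 2).
      by rewrite -[s ^- 2]opprK; exact: is_deriveN dI.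
    have := @is_derive1_comp R expR (fun t : R => - t^-1) s _ _ _ dN.
    by apply.
  have dq : is_derive s 1 (fun t : R => q.[t^-1]) (q^`().[s^-1] * - s ^- 2).
    apply: (@is_derive1_comp R (horner q) (fun t : R => t^-1)) => //.
    
  apply: (near_eq_is_derive (f := (fun t : R => q.[t^-1] * expR (- t^-1)))).
  + by near=> t; rewrite /flat ifT //; near: t; exact: lt_nbhsr.
  + apply: is_derive_eq; rewrite /flat s0 /dflat.
    rewrite -[LHS]/(q.[s^-1] * (expR (- s^-1) * s ^- 2) +
      expR (- s^-1) * (q^`().[s^-1] * - s ^- 2)).
    by rewrite !(hornerM, hornerD, hornerN, hornerX); field.
- have -> : flat (dflat q) 0 = 0 by rewrite /flat ltxx.
  have [K K0 HK] := flat_bound q.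
  have H : (fun h : R => h^-1 *: ((flat q \o shift 0) (h *: (1 : R)) - flat q 0))
      @ 0^' --> (0 : R).
    apply/cvgrPdist_lt => eps eps0; near=> h.
    rewrite sub0r normrN /= addr0 [h *: 1]mulr1 {2}/flat ltxx subr0.
    have hn0 : h != 0 by near: h; exact: nbhs_dnbhs_neq.
    have h1 : `|h| <= 1.
      by apply: ltW; near: h; exact: dnbhs0_lt.
    have h2 : `|h| < eps / (K + 1).
      by near: h; apply: dnbhs0_lt; rewrite divr_gt0 // ltr_wpDl.
    rewrite normrM normfV ltr_pdivrMl ?normr_gt0 //.
    apply: (le_lt_trans (HK _ h1)).
    rewrite -normr_id -[X in _ * X]real_normK ?num_real // normr_id expr2.
    rewrite mulrCA ltr_pM2l ?normr_gt0 //.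
    rewrite ltr_pdivlMr ?ltr_wpDl // in h2.
    by apply: le_lt_trans h2; rewrite mulrC ler_wpM2l // lerDl.
  by apply: DeriveDef; [apply/cvg_ex; exists 0|exact: cvg_lim H].
Unshelve. all: by end_near. Qed.

Lemma flat1_gt0 s : (0 < flat 1 s) = (0 < s).
Proof.
rewrite /flat; case: ifP => [s0|]; last by rewrite ltxx.
by rewrite hornerC mul1r expR_gt0.
Qed.

Lemma flat1_ge0 s : 0 <= flat 1 s.
Proof. by rewrite /flat; case: ifP => // _; rewrite hornerC mul1r expR_ge0. Qed.

Lemma flat1_eq0 s : s <= 0 -> flat 1 s = 0.
Proof. by rewrite /flat leNgt => /negbTE ->. Qed.

Lemma is_derive_comp1 (V : normedModType R) (g dg : R -> R) (f : V -> R) x v :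
  (forall t : R, is_derive t 1 g (dg t)) -> derivable f x v ->
  is_derive x v (g \o f) (dg (f x) * 'D_v f x).
Proof.
move=> Dg df.
have Ex : x = 0 *: v + x by rewrite scale0r add0r.
have Dl : is_derive (0:R) 1 (fun t : R => f (t *: v + x)) ('D_v f x).
  by have := @is_derive_line _ _ f x v 0; rewrite -Ex; exact.
have Dc : is_derive (0:R) 1 (fun t : R => (g \o f) (t *: v + x))
    (dg (f x) * 'D_v f x).
  have := @is_derive1_comp R g (fun t : R => f (t *: v + x)) 0 (dg (f x)) _ _ Dl.
  by rewrite -Ex; apply; exact: Dg.
have dc : derivable (g \o f) x v by apply/derivable1P; case: Dc.
have := @is_derive_line _ _ (g \o f) x v 0; rewrite -Ex => /(_ dc) [_ H].
by apply: DeriveDef => //; rewrite -H; case: Dc.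
Qed.

Context {n : nat}.
Local Notation E := 'rV[R]_n.

(** Smoothness by induction on k, simultaneously for all q: the derivative of
    [flat q] is the member [flat (dflat q)] of the same family. *)
Lemma Ck_flat k (U : set E) (f : E -> R) q :
  open U -> Ck k U f -> Ck k U (flat q \o f).
Proof.
move=> oU; have cf q' : continuous (flat q').
  move=> s; have [d _] := is_derive_flat q' s.
  by apply: differentiable_continuous; exact/derivable1_diffP.
elim: k f q => [|k IH] f q Cf.
  by split=> // x Ux; apply: continuous_comp; [exact: Ck_cont Cf _ Ux|exact: cf].
split=> [x Ux|i].
  by apply: continuous_comp; [exact: Ck_cont Cf _ Ux|exact: cf].
have [_ /(_ i) [df Cdf]] := Cf.
have D x : U x -> is_derive x (delta_mx 0 i) (flat q \o f)
    (flat (dflat q) (f x) * partial i f x).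
  by move=> Ux; apply: is_derive_comp1; [exact: is_derive_flat|exact: df].
split=> [x /D []//|].
apply: (@Ck_eq _ _ k U ((flat (dflat q) \o f) * partial i f)) => //.
  by move=> x /D [_ H]; rewrite /partial H.
by apply: CkM => //; apply: IH; exact: CkW.
Qed.

Lemma Ck_sqdist k (U : set E) (z : E) i (a b : R) : open U ->
  Ck k U (fun u => a * (u 0 i - z 0 i) ^+ 2 + b).
Proof.
move=> oU.
have C : Ck k U ((fun u : E => u 0 i) + cst (- z 0 i)).
  by apply: CkD => //; [exact: Ck_coord|exact: Ck_cst].
apply: (@Ck_eq _ _ k U (cst a * (((fun u : E => u 0 i) + cst (- z 0 i)) *
   ((fun u : E => u 0 i) + cst (- z 0 i))) + cst b)) => //.
apply: CkD => //; last exact: Ck_cst.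
by apply: CkM => //; [exact: Ck_cst|exact: CkM].
Qed.

Definition box_bump (z : E) (r : R) : E -> R :=
  \prod_(i < n) (flat 1 \o (fun u : E => - 1 * (u 0 i - z 0 i) ^+ 2 + r ^+ 2)).

Lemma box_bump_smooth z r : smooth_on setT (box_bump z r).
Proof.
move=> k; apply: Ck_prod => [|i]; first exact: openT.
by apply: Ck_flat; [exact: openT|exact/Ck_sqdist/openT].
Qed.

Lemma box_bump_ge0 z r u : 0 <= box_bump z r u.
Proof.
rewrite /box_bump fct_prodE; apply: prodr_ge0 => i _; exact: flat1_ge0.
Qed.

Lemma box_bump_neq0 z (r : R) u : 0 < r -> (box_bump z r u != 0) <-> ball z r u.
Proof.
move=> r0; rewrite /box_bump fct_prodE.
have H i : (flat 1 \o (fun u : E => - 1 * (u 0 i - z 0 i) ^+ 2 + r ^+ 2)) u != 0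
    = (`|z 0 i - u 0 i| < r).
  have -> (x : R) : (flat 1 x != 0) = (0 < x).
    by rewrite -flat1_gt0 lt0r flat1_ge0 andbT.
  rewrite mulN1r addrC subr_gt0 -[RHS](ltr_pXn2r (n := 2)) ?nnegrE ?normr_ge0 ?ltW //.
  by rewrite real_normK ?num_real // -sqrrN opprB.
split=> [/prodf_neq0 P|/ball_row[_ P]].
  by apply/ball_row; split=> // i; rewrite -H P.
by apply/prodf_neq0 => i _; rewrite H.
Qed.

(** With A positive exactly on the box of radius 2r and B positive exactly outside
    the closed box of radius r, the quotient A / (A + B) is the usual plateau. *)
Lemma box_plateau (z : E) (r : R) : 0 < r ->
  exists rho : E -> R, [/\ smooth_on setT rho,
    forall u, ball z r u -> rho u = 1 &
    forall u, rho u != 0 -> ball z (2 * r) u].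
Proof.
move=> r0; have r20 : 0 < 2 * r by rewrite mulr_gt0.
pose A := box_bump z (2 * r).
pose B : E -> R := \sum_(i < n)
  (flat 1 \o (fun u : E => 1 * (u 0 i - z 0 i) ^+ 2 + - (r ^+ 2))).
have sB : smooth_on setT B.
  move=> k; apply: Ck_sum => [|i]; first exact: openT.
  by apply: Ck_flat; [exact: openT|exact/Ck_sqdist/openT].
have B0 u : 0 <= B u.
  by rewrite /B fct_sumE; apply: sumr_ge0 => i _; exact: flat1_ge0.
(* Outside the open box of radius 2r some coordinate already makes B positive. *)
have AB u : A u + B u != 0.
  have := box_bump_ge0 z (2 * r) u; rewrite le_eqVlt => /predU1P[A0|A0].
    rewrite /A -A0 add0r.
    have : ~ ball z (2 * r) u by rewrite -box_bump_neq0 // -A0 eqxx.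
    move=> nb; have [i Hi] : exists i, ~~ (`|z 0 i - u 0 i| < 2 * r).
      apply/not_existsP => H; apply: nb; apply/ball_row; split=> // i.
      by apply/negP => /negP; exact: H.
    rewrite gt_eqF // /B fct_sumE (bigD1 i) //= ltr_pwDl //; last first.
      by apply: sumr_ge0 => j _; exact: flat1_ge0.
    rewrite flat1_gt0 mul1r subr_gt0 -[X in _ < X]sqrrN opprB.
    rewrite -[X in _ < X]real_normK ?num_real // ltr_pXn2r ?nnegrE ?normr_ge0 ?ltW //.
    by rewrite -leNgt in Hi; apply: lt_le_trans Hi; lra.
  by rewrite gt_eqF // ltr_wpDr.
exists (fun u => A u * (A u + B u)^-1); split.
- move=> k; apply: (@CkM _ _ k setT A (fun u => (A u + B u)^-1)).
  + exact: openT.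
  + exact: box_bump_smooth.
  + apply: (@CkV _ _ k setT (A + B)); first exact: openT.
      by move=> u _; exact: AB.
    by apply: CkD; [exact: openT|exact: box_bump_smooth|exact: sB].
- move=> u /ball_row[_ bu]; have -> : B u = 0.
    rewrite /B fct_sumE big1 // => i _ /=; apply: flat1_eq0.
    rewrite mul1r subr_le0 -[X in X <= _]sqrrN opprB.
    by rewrite -real_normK ?num_real // ler_pXn2r ?nnegrE ?normr_ge0 ?ltW // ltW.
  rewrite addr0 divff //; apply/box_bump_neq0 => //; apply/ball_row; split=> // i.
  by apply: lt_trans (bu i) _; lra.
- move=> u; rewrite mulf_eq0 negb_or => /andP[Au _].
  by apply/(box_bump_neq0 z u r20).
Qed.

End Flat.

(** * The Hadamard lemma *)

Section UnitIntegral.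
Context {R : realType}.
Local Notation I01 := (`[0, 1]%classic : set R).
Local Notation mu := (@lebesgue_measure R).
Implicit Types f g : R -> R.

Definition int01 f : R := \int[mu]_(t in I01) f t.

Definition cont01 f : Prop := forall t, I01 t -> {for t, continuous f}.

Lemma cont01_integrable f : cont01 f -> mu.-integrable I01 (EFin \o f).
Proof.
move=> cf; apply: continuous_compact_integrable; first exact: segment_compact.
by apply: continuous_in_subspaceT => t /set_mem; exact: cf.
Qed.

Lemma cont01D f g : cont01 f -> cont01 g -> cont01 (fun t => f t + g t).
Proof. by move=> cf cg t t01; apply: continuousD; [exact: cf|exact: cg]. Qed.

Lemma cont01M f g : cont01 f -> cont01 g -> cont01 (fun t => f t * g t).
Proof. by move=> cf cg t t01; apply: continuousM; [exact: cf|exact: cg]. Qed.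

Lemma cont01_cst (c : R) : cont01 (fun=> c).
Proof. by move=> t _; exact: cst_continuous. Qed.

Lemma int01D f g : cont01 f -> cont01 g ->
  int01 (fun t => f t + g t) = int01 f + int01 g.
Proof.
by move=> cf cg; apply: RintegralD; [exact: measurable_itv|exact: cont01_integrable..].
Qed.

Lemma int01Z (c : R) f : cont01 f -> int01 (fun t => c * f t) = c * int01 f.
Proof.
by move=> cf; apply: RintegralZl; [exact: measurable_itv|exact: cont01_integrable].
Qed.

Lemma int01_cst (c : R) : int01 (fun=> c) = c.
Proof.
rewrite /int01 Rintegral_cst ?measurable_itv //=.
by rewrite lebesgue_measure_itv /= lte_fin ltr01 sube0 mulr1.
Qed.

Lemma cont01_sum m (F : 'I_m -> R -> R) : (forall i, cont01 (F i)) ->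
  cont01 (fun t => \sum_(i < m) F i t).
Proof.
move=> cF; rewrite (_ : (fun t => _) = \sum_(i < m) F i).
  elim/big_ind: _ => [|f g|i _]; [exact: cont01_cst|exact: cont01D|exact: cF].
by apply/funext => t; rewrite fct_sumE.
Qed.

Lemma int01_sum m (F : 'I_m -> R -> R) : (forall i, cont01 (F i)) ->
  int01 (fun t => \sum_(i < m) F i t) = \sum_(i < m) int01 (F i).
Proof.
elim: m F => [|m IH] F cF.
  rewrite big_ord0 -[RHS](int01_cst 0); congr int01.
  by apply/funext => t; rewrite big_ord0.
rewrite big_ord_recl -IH // -int01D //; last exact: cont01_sum.
by congr int01; apply/funext => t; rewrite big_ord_recl.
Qed.

Lemma int01_close f g (eps : R) : cont01 f -> cont01 g ->
  (forall t, I01 t -> `|f t - g t| <= eps) -> `|int01 f - int01 g| <= eps.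
Proof.
move=> cf cg fg.
have cB : cont01 (fun t => f t - g t).
  by move=> t t01; apply: continuousB; [exact: cf|exact: cg].
have -> : int01 f - int01 g = int01 (fun t => f t - g t).
  by rewrite /int01 RintegralB //; exact: cont01_integrable.
apply: le_trans.
  by apply: le_normr_Rintegral => //; exact: cont01_integrable.
rewrite -[leRHS]int01_cst; apply: le_Rintegral => //.
  have : cont01 (fun t => `|f t - g t|).
    by move=> t t01; apply: (continuous_comp (cB _ t01)); exact: norm_continuous.
  exact: cont01_integrable.
by apply: cont01_integrable; exact: cont01_cst.
Qed.

Lemma int01_FTC F f : (forall t, I01 t -> is_derive t 1 F (f t)) ->
  cont01 f -> int01 f = F 1 - F 0.
Proof.
move=> dF cf.
have cF : cont01 F.
  move=> t /dF [d _]; apply: differentiable_continuous; exact/derivable1_diffP.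
have sub t : t \in `]0, 1[ -> I01 t by exact: subset_itv_oo_cc.
rewrite /int01 /Rintegral (@continuous_FTC2 _ f F 0 1) //.
- by apply: continuous_in_subspaceT => t /set_mem; exact: cf.
- split.
  + by move=> t /sub /dF [].
  + by apply: cvg_at_right_filter; apply: cF; rewrite /= in_itv /= lexx ler01.
  + by apply: cvg_at_left_filter; apply: cF; rewrite /= in_itv /= lexx ler01.
- by move=> t /sub /dF [_ E]; rewrite derive1E.
Qed.

End UnitIntegral.

Section Hadamard.
Context {R : realType} {n : nat}.
Local Notation E := 'rV[R]_n.
Local Notation I01 := (`[0, 1]%classic : set R).
Variables (W : set E) (z : E).
Hypothesis oW : open W.
Hypothesis starW : forall u t, W u -> I01 t -> W (t *: (u - z) + z).
Implicit Types F : E -> R.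

Definition ray (t : R) (u : E) : E := t *: (u - z) + z.

(** For m = 0 these are the quotients of the Hadamard lemma.  Derivation under
    the integral sign multiplies the integrand by t, and the weights t^m make the
    family stable under it. *)
Definition moment (m : nat) F (u : E) : R := int01 (fun t => t ^+ m * F (ray t u)).

Lemma ray_continuous (x : R * E) : {for x, continuous (fun x => ray x.1 x.2)}.
Proof.
apply: continuousD; last exact: cst_continuous.
apply: (@continuousZ R E (R * E)%type (fun x => x.1) (fun x => x.2 - z)).
  exact: cvg_fst.
apply: (@continuousB R E (R * E)%type (fun x => x.2) (fun=> z)).
  exact: cvg_snd.
exact: cst_continuous.
Qed.

Lemma cont_ray m F u : W u -> Ck 0 W F -> cont01 (fun t => t ^+ m * F (ray t u)).
Proof.
move=> Wu [cF _]; apply: cont01M => t t01; first exact: exprn_continuous.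
apply: continuous_comp; last by apply: cF; exact: starW.
apply: continuousD; last exact: cst_continuous.
apply: (@continuousZ R E R id (fun=> u - z)) => //; exact: cst_continuous.
Qed.

(** Compactness of [0,1] makes continuity uniform along the segment. *)
Lemma near_ray F u eps : W u -> Ck 0 W F -> 0 < eps ->
  \forall v \near nbhs u, forall t, I01 t -> `|F (ray t v) - F (ray t u)| < eps.
Proof.
move=> Wu [cF _] eps0.
have /compact_near_coveringP cov := @segment_compact R 0 1.
apply: (cov E (nbhs u) (fun v t => `|F (ray t v) - F (ray t u)| < eps)) => t t01.
have Wt : W (ray t u) by exact: starW.
have c1 : {for (t, u), continuous (fun x : R * E => F (ray x.1 x.2))}.
  by apply: continuous_comp; [exact: ray_continuous|exact: cF].
have c2 : {for (t, u), continuous (fun x : R * E => F (ray x.1 u))}.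
  apply: (@continuous_comp _ _ _ (fun x : R * E => ray x.1 u) F); last exact: cF.
  apply: continuousD; last exact: cst_continuous.
  apply: (@continuousZ R E (R * E)%type (fun x => x.1) (fun=> u - z));
    last exact: cst_continuous.
  exact: cvg_fst.
have c12 : {for (t, u), continuous
    (fun x : R * E => F (ray x.1 x.2) - F (ray x.1 u))} := continuousB c1 c2.
have /cvgrPdist_lt /(_ _ eps0) := c12.
rewrite /= subrr.
by apply: filterS => x /=; rewrite sub0r normrN.
Qed.

Lemma moment_continuous m F u : W u -> Ck 0 W F -> {for u, continuous (moment m F)}.
Proof.
move=> Wu CF; have FF : Filter (nbhs u) by exact: nbhs_filter.
apply/(@cvgrPdist_le _ _ _ (nbhs u)) => eps eps0.
have nW : nbhs u W by exact: open_nbhs_nbhs.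
apply: filterS (filterI nW (near_ray Wu CF eps0)) => v [Wv H].
apply: int01_close; try exact: cont_ray.
move=> t t01; rewrite -mulrBr normrM distrC -[leRHS]mul1r.
apply: ler_pM => //; last by apply: ltW; exact: H.
move: t01; rewrite /= in_itv /= => /andP[t0 t1].
by rewrite normrX ger0_norm // exprn_ile1.
Qed.

(** Derivation under the integral sign: by the mean value theorem the difference
    quotient of the integrand is its derivative at a nearby point, uniformly in t
    by [near_ray]. *)
Lemma moment_derive m F i u : W u -> Ck 1 W F ->
  is_derive u (delta_mx 0 i) (moment m F) (moment m.+1 (partial i F) u).
Proof.
move=> Wu CF.
have C0F : Ck 0 W F by exact: CkW.
have [_ /(_ i) [dF CdF]] := CF.
set e := delta_mx 0 i.
have H : (fun h : R => h^-1 *: ((moment m F \o shift u) (h *: e) - moment m F u))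
   @ 0^' --> moment m.+1 (partial i F) u.
  apply/cvgrPdist_le => eps eps0.
  have nW : nbhs u W by exact: open_nbhs_nbhs.
  have : nbhs u (fun v => W v /\ forall t, I01 t ->
      `|partial i F (ray t v) - partial i F (ray t u)| < eps).
    by apply: filterI nW _; exact: near_ray.
  move=> /nbhs_ballP [d /= d0 dH].
  have B (c : R) : `|c| < d -> ball u d (c *: e + u).
    move=> cd; apply/ball_row; split=> // j; rewrite !mxE eqxx /= opprD addrCA subrr.
    rewrite addr0 normrN; case: eqP => _; by rewrite ?mulr1 // mulr0 normr0.
  near=> h.
  have hd : `|h| < d by near: h; exact: dnbhs0_lt.
  have hn0 : h != 0 by near: h; exact: nbhs_dnbhs_neq.
  have [Wh _] := dH _ (B _ hd).
  rewrite /= -(ler_pM2l (x := `|h|)) ?normr_gt0 // -normrM mulrBr distrC.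
  rewrite [h * (_ *: _)]mulVKf //.
  have -> : moment m F (h *: e + u) - moment m F u -
      h * moment m.+1 (partial i F) u = moment m F (h *: e + u) -
      int01 (fun t => t ^+ m * F (ray t u) +
             h * (t ^+ m.+1 * partial i F (ray t u))).
    rewrite int01D; first by rewrite int01Z ?opprD ?addrA //; exact: cont_ray.
      exact: cont_ray.
    by apply: cont01M; [exact: cont01_cst|exact: cont_ray].
  apply: int01_close; first exact: cont_ray.
    apply: cont01D; first exact: cont_ray.
    by apply: cont01M; [exact: cont01_cst|exact: cont_ray].
  move=> t t01.
  have rE (c : R) : ray t (c *: e + u) = (t * c) *: e + ray t u.
    by rewrite /ray -!addrA scalerDr scalerA addrA.
  have [|c cle HE] := @MVT_from0 _ (fun s => F (ray t (s *: e + u)))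
      (fun s => partial i F (ray t (s *: e + u)) * t) h.
    move=> s sh; have [Ws _] := dH _ (B _ (le_lt_trans sh hd)).
    have Wr : W (ray t (s *: e + u)) by exact: starW.
    rewrite (_ : (fun s => F _) = (fun s => F (s *: e + ray t u)) \o ( *%R t)).
      apply: is_derive1_comp.
        by rewrite rE; apply: is_derive_line; apply: dF; rewrite -rE.
      rewrite -{2}[t]mulr1; apply: (@is_deriveZ R R R id t s 1 1).
    by apply/funext => s' /=; rewrite rE.
  have [_ Hc] := dH _ (B _ (le_lt_trans cle hd)).
  rewrite scale0r add0r in HE; rewrite opprD addrA -mulrBr HE.
  set p1 := partial i F _; set p2 := partial i F _.
  have -> : t ^+ m * (h * (p1 * t)) - h * (t ^+ m.+1 * p2) =
     h * (t ^+ m.+1 * (p1 - p2)) by rewrite exprS; ring.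
  rewrite normrM ler_wpM2l // normrM -[leRHS]mul1r.
  have p12 : `|p1 - p2| <= eps by apply: ltW; exact: Hc.
  apply: ler_pM => //.
  move: t01; rewrite /= in_itv /= => /andP[t0 t1].
  by rewrite normrX ger0_norm // exprn_ile1.
by apply: DeriveDef; [apply/cvg_ex; eexists; exact: H|exact: cvg_lim H].
Unshelve. all: by end_near. Qed.

Lemma moment_Ck k m F : Ck k W F -> Ck k W (moment m F).
Proof.
elim: k m F => [|k IH] m F CF.
  by split=> // x Wx; apply: moment_continuous => //; exact: Ck_le CF.
split=> [x Wx|i]; first by apply: moment_continuous => //; exact: Ck_le CF.
have C1 : Ck 1 W F by exact: Ck_le CF.
split=> [x Wx|]; first by have [] := moment_derive m i Wx C1.
apply: (@Ck_eq _ _ k W (moment m.+1 (partial i F))) => //.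
  by move=> x Wx; have [_] := moment_derive m i Wx C1.
by apply: IH; have [_ /(_ i) []] := CF.
Qed.

(** The fundamental theorem of calculus along the segment from z to u. *)
Lemma Hadamard F u : W u -> Ck 1 W F ->
  F u - F z = \sum_(i < n) (u 0 i - z 0 i) * moment 0 (partial i F) u.
Proof.
move=> Wu CF.
have Cp i : Ck 0 W (partial i F) by have [_ /(_ i) []] := CF.
have cr i : cont01 (fun t => t ^+ 0 * partial i F (ray t u)) by exact: cont_ray.
under eq_bigr do rewrite -int01Z //.
rewrite -int01_sum; last by move=> i; apply: cont01M => //; exact: cont01_cst.
have -> : F u - F z = F (ray 1 u) - F (ray 0 u).
  by rewrite /ray scale1r subrK scale0r add0r.
apply/esym; apply: (@int01_FTC R (fun t => F (ray t u))) => [t t01|]; last first.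
  by apply: cont01_sum => i; apply: cont01M => //; exact: cont01_cst.
have dj j : is_derive t 1 (fun t : R => ray t u 0 j) (u 0 j - z 0 j).
  rewrite (_ : (fun t => _) = ((fun s : R => (u 0 j - z 0 j) *: s) + cst (z 0 j))).
    rewrite -[X in is_derive _ _ _ X]addr0 -[X in X + 0]mulr1.
    by apply: is_deriveD; exact: (@is_deriveZ R R R id _ t 1 1).
  by apply/funext => s; rewrite /ray !mxE !fctE /GRing.scale /= mulrC.
have [|D E1] := @chain_rule R n R W F (fun t => ray t u) t 1 oW (starW Wu t01) CF.
  by move=> j; case: (dj j).
apply: DeriveDef; first exact: D.
rewrite [LHS]E1; apply: eq_bigr => j _; have [_ ->] := dj j.
by rewrite expr0 mul1r mulrC.
Qed.

Lemma moment_center F : moment 0 F z = F z.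
Proof.
rewrite /moment -[RHS]int01_cst; congr int01; apply/funext => t.
by rewrite /ray subrr scaler0 add0r expr0 mul1r.
Qed.

End Hadamard.

(** * Local frames on a manifold *)

(* From here on [coord] is the coordinate map of a chart. *)
Import Defs.

Section BallStar.
Context {R : realType} {n : nat}.
Local Notation E := 'rV[R]_n.

Lemma ball_star (x z u : E) (e t : R) : ball x e z -> ball x e u ->
  (`[0, 1]%classic : set R) t -> ball x e (t *: (u - z) + z).
Proof.
move=> /ball_row [e0 bz] /ball_row[_ bu] /=; rewrite in_itv /= => /andP[t0 t1].
apply/ball_row; split=> // i; rewrite !mxE.
have -> : x 0 i - (t * (u 0 i - z 0 i) + z 0 i) =
   t * (x 0 i - u 0 i) + (1 - t) * (x 0 i - z 0 i) by ring.
apply: (le_lt_trans (ler_normD _ _)); rewrite !normrM (ger0_norm t0).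
rewrite (ger0_norm (x := 1 - t)) ?subr_ge0 //.
have := bz i; have := bu i; move: `|_ - u _ _| `|_ - z _ _| => a b ae be.
have [->|tn0] := eqVneq t 0; first by rewrite mul0r add0r subr0 mul1r.
have tp : 0 < t by rewrite lt0r tn0.
nra.
Qed.

Lemma closed_box_compact (x : E) (e : R) :
  compact [set u : E | forall i, `|x 0 i - u 0 i| <= e].
Proof.
have -> : [set u : E | forall i, `|x 0 i - u 0 i| <= e] =
    [set u : E | forall i, `[x 0 i - e, x 0 i + e]%classic (u 0 i)].
  apply/seteqP; split=> u /= H i; move: (H i); rewrite in_itv /= ler_norml; lra.
apply: (@rV_compact R n (fun i => `[x 0 i - e, x 0 i + e]%classic)) => i.
exact: segment_compact.
Qed.

End BallStar.

Section Manifold.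
Context {R : realType} {n : nat} {M : smoothManifold R n}.
Local Notation E := 'rV[R]_n.
Local Notation C := (Cinf M).

(** Charts are homeomorphisms, so they carry open sets to open sets. *)
Lemma coord_image_open (d : chart R n M) (A : set M) :
  open A -> open (coord d @` (cdom d `&` A)).
Proof.
move=> oA; rewrite openE => _ [q [dq Aq] <-].
have im : (coord d @` cdom d) (coord d q) by exists q.
have pc := param_continuous im.
have nA : nbhs (param d (coord d q)) A.
  by rewrite coordK //; exact: open_nbhs_nbhs.
have nI : nbhs (coord d q) (coord d @` cdom d).
  by apply: open_nbhs_nbhs; split=> //; exact: cimage_open.
apply: filterS (filterI nI (pc _ nA)) => u [[q' dq' <-]] /=.
by rewrite coordK // => Aq'; exists q'.
Qed.

Lemma coord_preimage_open (c : chart R n M) (W : set E) :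
  open W -> open (cdom c `&` [set q | W (coord c q)]).
Proof.
move=> oW; rewrite openE => q [cq Wq].
have n1 : nbhs q (cdom c).
  by apply: open_nbhs_nbhs; split=> //; exact: cdom_open.
have n2 : nbhs (coord c q) W by exact: open_nbhs_nbhs.
by apply: filterI n1 _; exact: (coord_continuous cq n2).
Qed.

Section Glue.
Variables (c : chart R n M) (W K : set E).
Hypothesis Ac : atlas c.
Hypothesis oW : open W.
Hypothesis Wim : W `<=` coord c @` cdom c.
Hypothesis cK : compact K.
Hypothesis KW : K `<=` W.

Definition glue (h : E -> R) (q : M) : R :=
  if `[< cdom c q /\ W (coord c q) >] then h (coord c q) else 0.

Lemma glueT h q : cdom c q -> W (coord c q) -> glue h q = h (coord c q).
Proof. by move=> cq Wq; rewrite /glue; case: asboolP => // -[]. Qed.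

(** In another chart d, the points of the manifold are covered by two open sets:
    the domain over W, where the function is h after a smooth change of
    coordinates, and the complement of the image of K, where it vanishes.  The
    latter is open because the image of K is compact in a Hausdorff space. *)
Lemma glue_smooth h : smooth_on W h -> (forall u, W u -> ~ K u -> h u = 0) ->
  glue h \in smooth_pred M.
Proof.
move=> sh h0; apply/asboolP => d Ad k.
pose Q := cdom c `&` [set q | W (coord c q)].
have oQ : open Q by exact: coord_preimage_open.
(* The transported function vanishes off KM. *)
pose KM := param c @` K.
have cKM : closed KM.
  apply: compact_closed; first exact: space_hausdorff.
  apply: continuous_compact => //.
  apply: continuous_in_subspaceT => u /set_mem /KW /Wim; exact: param_continuous.
apply: Ck_local => y [q dq qy].
have [Qq|nQq] := pselect (Q q).
  exists (coord d @` (cdom d `&` Q)); first by exists q.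
  have oU := coord_image_open (d := d) oQ.
  apply: (@Ck_eq _ _ k _ (h \o (fun u => coord c (param d u)))) => //.
    by move=> _ [q' [dq' [cq' Wq']] <-] /=; rewrite coordK // glueT.
  apply: (Ck_comp oU oW) => //.
    by move=> _ [q' [dq' [cq' Wq']] <-] /=; rewrite coordK.
  move=> j; apply: Ck_sub (atlas_compat Ad Ac j k).
  by move=> _ [q' [dq' [cq' Wq']] <-]; exists q'.
have oU : open (coord d @` (cdom d `&` ~` KM)).
  by apply: coord_image_open; exact: closed_openC.
exists (coord d @` (cdom d `&` ~` KM)).
  exists q => //; split=> // -[u Ku uq]; apply: nQq.
  have [q' cq' q'u] := Wim (KW Ku).
  by rewrite -uq -q'u coordK //; split=> //=; rewrite q'u; exact: KW.
apply: (@Ck_eq _ _ k _ (cst 0)) => //; last exact: Ck_cst.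
move=> _ [q' [dq' nK] <-] /=; rewrite coordK // /glue; case: asboolP => // -[cq' Wq'].
by rewrite h0 // => Kq'; apply: nK; exists (coord c q') => //; exact: coordK.
Qed.

End Glue.

Section Tangent.
Variables (p : M) (v : tangent p).

Lemma tangent_derivation : derivation_at p v.
Proof. by case: v => w hw; exact/asboolP. Qed.

Lemma tangentD f g : v (f + g) = v f + v g.
Proof. by have [] := tangent_derivation. Qed.

Lemma tangentM f g : v (f * g) = f p * v g + g p * v f.
Proof. by have [] := tangent_derivation. Qed.

Lemma tangentZ a f : v (cinf_cst M a * f) = a * v f.
Proof. by have [] := tangent_derivation. Qed.

Lemma tangent0 : v 0 = 0.
Proof. by apply: (@addrI _ (v 0)); rewrite -tangentD !addr0. Qed.

Lemma tangentN f : v (- f) = - v f.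
Proof. by apply: (@addrI _ (v f)); rewrite -tangentD !subrr tangent0. Qed.

Lemma tangent_sum m (F : 'I_m -> C) : v (\sum_(i < m) F i) = \sum_(i < m) v (F i).
Proof. by apply: (big_morph v tangentD tangent0). Qed.

Lemma tangent_cst a : v (cinf_cst M a) = 0.
Proof.
have H : v 1 = 0.
  have := tangentM 1 1; rewrite mul1r -[(1 : C) p]/(1 : R) !mul1r => H.
  by apply: (@addrI _ (v 1)); rewrite addr0 -H.
by rewrite -[cinf_cst M a]mulr1 tangentZ H mulr0.
Qed.

End Tangent.

Lemma cinfP (f g : C) : (forall q, f q = g q) -> f = g.
Proof. by move=> fg; apply/val_inj/funext. Qed.

Lemma cinf_sumE m (F : 'I_m -> C) q : (\sum_(i < m) F i) q = \sum_(i < m) F i q.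
Proof. by elim/big_ind2: _ => // f a g b <- <-. Qed.

Section Frame.
Variable p : M.
Variable c : chart R n M.
Hypothesis Ac : atlas c.
Hypothesis cp : cdom c p.
Variable r : R.
Hypothesis r0 : 0 < r.
Local Notation W := (ball (coord c p : E) (4 * r)).
Hypothesis Wim : W `<=` coord c @` cdom c.
Variables rho rho1 : E -> R.
Hypothesis srho : smooth_on setT rho.
Hypothesis srho1 : smooth_on setT rho1.
Hypothesis rhoN0 : forall u, (rho u != 0) <-> ball (coord c p : E) r u.
Hypothesis rho1_1 : forall u, ball (coord c p : E) r u -> rho1 u = 1.
Hypothesis rho1_0 : forall u, rho1 u != 0 -> ball (coord c p : E) (2 * r) u.

Let K := [set u : E | forall i, `|coord c p 0 i - u 0 i| <= 2 * r].

Let oW : open W.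
Proof. exact: ball_open. Qed.

Let KW : K `<=` W.
Proof.
move=> u Ku; apply/ball_row; split=> [|i]; first by rewrite mulr_gt0.
by apply: le_lt_trans (Ku i) _; rewrite ltr_pM2r // ltr_nat.
Qed.

Lemma frame_glue rh h : smooth_on setT rh ->
  (forall u, rh u != 0 -> ball (coord c p : E) (2 * r) u) ->
  smooth_on W h -> glue c W (rh * h) \in smooth_pred M.
Proof.
move=> sr r1 sh; apply: (glue_smooth (K := K)) => //.
- exact: closed_box_compact.
- by move=> k; apply: CkM => //; exact: Ck_sub (sr k).
- move=> u Wu nK; rewrite !fctE.
  have -> : rh u = 0; last by rewrite mul0r.
  apply/eqP/negPn/negP => /r1 /ball_row[_ bu]; apply: nK => i.
  by apply: ltW; exact: bu.
Qed.

Let rho_2r u : rho u != 0 -> ball (coord c p : E) (2 * r) u.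
Proof.
move=> /rhoN0; have H : r <= 2 * r by rewrite ler_peMl ?ler1n ?ltW.
exact: (@le_ball _ E _ _ _ H u).
Qed.

Let smooth_loc (f : C) : smooth_on W (f \o param c).
Proof.
have sf : smooth_fct f by case: f => f' hf; apply/asboolP.
by move=> k; exact: Ck_sub (sf c Ac k).
Qed.

Let smooth_partial (f : C) i : smooth_on W (partial i (f \o param c)).
Proof. by move=> k; have [_ /(_ i) []] := smooth_loc f k.+1. Qed.

Let smooth1 : smooth_on W (cst 1).
Proof. by move=> k; exact: Ck_cst. Qed.

Let smoothX i : smooth_on W (fun u : E => u 0 i).
Proof. by move=> k; exact: Ck_coord. Qed.

(** The cutoff rho is for vector fields and rho1, which is 1 wherever rho is
    nonzero, for functions: wherever the frame does not vanish the functions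
    [coordfn] are genuine coordinates. *)
Definition cutoff : C := MkCinf (frame_glue srho rho_2r smooth1).
Definition cutoff1 : C := MkCinf (frame_glue srho1 rho1_0 smooth1).
Definition coordfn i : C := MkCinf (frame_glue srho1 rho1_0 (@smoothX i)).
Definition framefn i (f : C) : C :=
  MkCinf (frame_glue srho rho_2r (@smooth_partial f i)).

Let derivable_loc (f : C) i u : W u -> derivable (f \o param c) u (delta_mx 0 i).
Proof. by move=> Wu; have [_ /(_ i) [+ _]] := smooth_loc f 1; exact. Qed.

Lemma frame_subproof i : (framefn i : C -> C^o) \in vfield_pred.
Proof.
apply/asboolP; split=> [f g|a f|f g]; apply: cinfP => q /=.
- rewrite -[RHS]/(framefn i f q + framefn i g q) /= /glue.
  case: asboolP => [[cq Wq]|_]; last by rewrite addr0.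
  by rewrite !fctE -mulrDr; congr (_ * _); rewrite /partial deriveD //; exact: derivable_loc.
- rewrite -[RHS]/(a * framefn i f q) /= /glue.
  case: asboolP => [[cq Wq]|_]; last by rewrite mulr0.
  rewrite !fctE mulrCA; congr (_ * _).
  by rewrite /partial -[RHS]deriveZ //; exact: derivable_loc.
- rewrite -[RHS]/(f q * framefn i g q + g q * framefn i f q) /= /glue.
  case: asboolP => [[cq Wq]|_]; last by rewrite !mulr0 addr0.
  rewrite !fctE /partial -[X in 'D_(_) X _]/((f \o param c) * (g \o param c)).
  rewrite deriveM; try exact: derivable_loc.
  rewrite /GRing.scale /= coordK //; ring.
Qed.

Definition frame i : vfield M := VField (frame_subproof i).

Let ballr_W u : ball (coord c p : E) r u -> W u.
Proof.
have H : r <= 4 * r by rewrite ler_peMl ?ler1n ?ltW.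
exact: (@le_ball _ E _ _ _ H u).
Qed.

Lemma cutoff_neq0 : cutoff p != 0.
Proof.
have bp : ball (coord c p : E) r (coord c p) by exact: ballxx.
by rewrite /= glueT //; [rewrite !fctE mulr1; exact/rhoN0|exact: ballr_W].
Qed.

(** Near p the function [coordfn j] is the j-th coordinate, since the cutoff rho1
    equals 1 there. *)
Lemma frame_coordfn i j : frame i (coordfn j) p = cutoff p * (i == j)%:R.
Proof.
have bp : ball (coord c p : E) r (coord c p) by exact: ballxx.
rewrite /= !glueT //; try exact: ballr_W.
rewrite !fctE mulr1; congr (_ * _).
have [_ H] := is_derive_coord j i (coord c p).
rewrite eq_sym -H /partial; apply: near_eq_derive.
have nb : nbhs (coord c p) (ball (coord c p : E) r) by exact: nbhsx_ballx.
apply: filterS nb => u bu /=; have Wu := ballr_W bu.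
have [q cq qu] := Wim Wu.
by rewrite -qu coordK // glueT ?qu // rho1_1 // mul1r.
Qed.

(** Where the cutoff vanishes both sides do.  At any other q, rho1 is 1 and the
    Hadamard lemma at q writes (f - f(q)) cutoff1^2 as a sum of products
    X_i G_i of globally smooth functions with X_i(q) = 0; applying v and using
    v(cutoff1) = 0 leaves v(f) as the sum of the v(X_i) G_i(q), and G_i(q) is the
    partial derivative of f. *)
Lemma frame_expand q (v : tangent q) (f : C) :
  cutoff q * v f = \sum_(i < n) v (coordfn i) * frame i f q.
Proof.
have [[cq Wq]|nQ] := pselect (cdom c q /\ W (coord c q)); last first.
  have g0 h : glue c W h q = 0 by rewrite /glue; case: asboolP.
  by rewrite /= g0 mul0r big1 // => i _; rewrite g0 mulr0.
have [rq|rq] := eqVneq (rho (coord c q)) 0.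
  rewrite /= glueT // !fctE rq mul0r mul0r big1 // => i _.
  by rewrite glueT // !fctE rq mul0r mulr0.
have bq : ball (coord c p : E) r (coord c q) by exact/rhoN0.
set uq := coord c q; set F := f \o param c.
have sF : smooth_on W F := smooth_loc f.
have star u t : W u -> (`[0, 1]%classic : set R) t -> W (t *: (u - uq) + uq).
  by move=> Wu; exact: ball_star.
pose g i := moment uq 0 (partial i F).
have sg i : smooth_on W (g i).
  by move=> k; apply: moment_Ck => //; exact: smooth_partial.
pose G i : C := MkCinf (frame_glue srho1 rho1_0 (sg i)).
have cut1q : cutoff1 q = 1 by rewrite /= glueT // !fctE rho1_1 // mulr1.
(* cutoff * cutoff1 = cutoff and cutoff is nonzero at q. *)
have vcut1 : v cutoff1 = 0.
  have E1 : cutoff * cutoff1 = cutoff.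
    apply: cinfP => q'; rewrite -[LHS]/(cutoff q' * cutoff1 q') /= /glue.
    case: asboolP => [[cq' Wq']|_]; last by rewrite mulr0.
    rewrite !fctE !mulr1; have [->|/rhoN0 b] := eqVneq (rho (coord c q')) 0.
      by rewrite mul0r.
    by rewrite rho1_1 ?mulr1.
  have := tangentM v cutoff cutoff1; rewrite E1 cut1q mul1r -[LHS]add0r.
  move=> /addIr /esym /eqP; rewrite mulf_eq0 => /orP[|/eqP //].
  by rewrite /= glueT // !fctE mulr1 (negbTE rq).
pose X i : C := coordfn i - cinf_cst M (uq 0 i) * cutoff1.
have key : cutoff1 * cutoff1 * (f - cinf_cst M (f q)) = \sum_(i < n) X i * G i.
  apply: cinfP => q'; rewrite cinf_sumE.
  rewrite -[LHS]/(cutoff1 q' * cutoff1 q' * (f q' - f q)).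
  under eq_bigr do rewrite -[(X _ * G _) q']/((coordfn _ q' - uq 0 _ * cutoff1 q') * G _ q').
  rewrite /= /glue; case: asboolP => [[cq' Wq']|_]; last first.
    by rewrite !mul0r big1 // => i _; rewrite mulr0.
  rewrite !fctE mulr1.
  have -> : f q' - f q = F (coord c q') - F uq by rewrite /F /= !coordK.
  rewrite (Hadamard (z := uq) oW star Wq' (sF 1)) mulr_sumr.
  by apply: eq_bigr => i _; rewrite !fctE /g; ring.
have vX i : v (X i) = v (coordfn i).
  by rewrite tangentD tangentN tangentZ vcut1 mulr0 oppr0 addr0.
have Xq i : X i q = 0.
  rewrite -[LHS]/(coordfn i q - uq 0 i * cutoff1 q) cut1q mulr1 /= glueT //.
  by rewrite !fctE rho1_1 // mul1r subrr.
have := congr1 v key.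
rewrite tangent_sum tangentM -[(cutoff1 * cutoff1) q]/(cutoff1 q * cutoff1 q).
rewrite cut1q !mul1r -[(f - _) q]/(f q - f q) subrr mul0r addr0.
rewrite tangentD tangentN tangent_cst subr0 => ->.
rewrite mulr_sumr; apply: eq_bigr => i _.
rewrite tangentM Xq mul0r add0r vX /= !glueT // !fctE.
rewrite rho1_1 // mul1r /g moment_center; ring.
Qed.

End Frame.

(** This is all that the study of the curvature needs to know about charts. *)
Lemma local_frame (p : M) : exists (rho : C) (X : 'I_n -> C) (D : 'I_n -> vfield M),
  [/\ rho p != 0,
      forall q (v : tangent q) f, rho q * v f = \sum_(i < n) v (X i) * D i f q &
      forall i j, D i (X j) p = rho p * (i == j)%:R].
Proof.
have [c Ac cp] := atlas_cover p.
have /nbhs_ballP [e /= e0 eW] : nbhs (coord c p) (coord c @` cdom c).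
  by apply: open_nbhs_nbhs; split; [exact: cimage_open|exists p].
pose r := e / 4; have r0 : 0 < r by rewrite divr_gt0.
have re : 4 * r = e by rewrite /r mulrC divfK.
have [rho1 [s1 H1 H0]] := box_plateau (coord c p : 'rV[R]_n) r0.
have Wim : ball (coord c p : 'rV[R]_n) (4 * r) `<=` coord c @` cdom c by rewrite re.
have sr := box_bump_smooth (coord c p : 'rV[R]_n) r.
have rN u := box_bump_neq0 (coord c p : 'rV[R]_n) u r0.
exists (cutoff Ac r0 Wim sr rN), (coordfn Ac r0 Wim s1 H0), (frame Ac r0 Wim sr rN).
split.
- exact: cutoff_neq0.
- by move=> q v f; apply: frame_expand.
- by move=> i j; apply: frame_coordfn.
Qed.

End Manifold.

(** * Tensoriality and symmetries of the curvature *)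

Section VectorFields.
Context {R : realType} {n : nat} {M : smoothManifold R n}.
Local Notation C := (Cinf M).
Implicit Types (X Y Z : vfield M) (f h : C) (p : M).

Lemma vfieldP X Y : (forall h, X h = Y h) -> X = Y.
Proof. by move=> XY; apply/val_inj/funext. Qed.

Lemma tangentP p (v w : tangent p) : (forall h, v h = w h) -> v = w.
Proof. by move=> vw; apply/val_inj/funext. Qed.

Lemma vfieldD X f h : X (f + h) = X f + X h.
Proof. by have [] := vfield_derivation X. Qed.

Lemma vfieldM X f h : X (f * h) = f * X h + h * X f.
Proof. by have [] := vfield_derivation X. Qed.

Lemma vfield0 X : X 0 = 0.
Proof. by apply: (@addrI _ (X 0)); rewrite -vfieldD !addr0. Qed.

Lemma vfieldN X f : X (- f) = - X f.
Proof. by apply: (@addrI _ (X f)); rewrite -vfieldD !subrr vfield0. Qed.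

Lemma add_vfieldE X Y h : (X + Y) h = X h + Y h. Proof. by []. Qed.
Lemma opp_vfieldE X h : (- X) h = - X h. Proof. by []. Qed.
Lemma scale_vfieldE f X h : (f *: X) h = f * X h. Proof. by []. Qed.
Lemma lieE X Y h : lie X Y h = X (Y h) - Y (X h). Proof. by []. Qed.

Definition vfieldE := (add_vfieldE, opp_vfieldE, scale_vfieldE, lieE,
  vfieldD, vfieldN, vfieldM).

Lemma sum_vfieldE m (F : 'I_m -> vfield M) h : (\sum_(i < m) F i) h = \sum_(i < m) F i h.
Proof. by elim/big_ind2: _ => // a b c d <- <-. Qed.

Lemma valueD p X Y : value p (X + Y) = value p X + value p Y.
Proof. exact: tangentP. Qed.

Lemma valueZ p f X : value p (f *: X) = f p *: value p X.
Proof. exact: tangentP. Qed.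

Lemma value_sum p m (F : 'I_m -> vfield M) :
  value p (\sum_(i < m) F i) = \sum_(i < m) value p (F i).
Proof.
apply: (big_morph (value p) (valueD p)); exact: tangentP.
Qed.

Lemma sum_tangentE p m (F : 'I_m -> tangent p) h :
  (\sum_(i < m) F i) h = \sum_(i < m) F i h.
Proof. by elim/big_ind2: _ => // a b c d <- <-. Qed.

(** At p the expansion in the local frame can be divided by rho(p), and the dual
    functions X_j read off the coefficients. *)
Lemma tangent_basis p : exists e : 'I_n -> vfield M, is_basis (fun i => value p (e i)).
Proof.
have [rho [X [D [r0 expand dual]]]] := local_frame p.
exists D => v; exists (\row_i (v (X i) / rho p)); split.
  apply: tangentP => h; rewrite sum_tangentE.
  rewrite (eq_bigr (fun i => v (X i) / rho p * D i h p)); last first.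
    by move=> i _; rewrite mxE.
  rewrite -[LHS](mulfK r0) mulrC [v h * _]mulrC expand mulr_sumr.
  by apply: eq_bigr => i _; ring.
move=> a va; apply/rowP => j; rewrite mxE va sum_tangentE.
rewrite (bigD1 j) //= big1 ?addr0 => [|i ij].
  by rewrite -[X in X / _]/(a 0 j * D j (X j) p) dual eqxx mulr1 mulfK.
by rewrite -[LHS]/(a 0 i * D i (X j) p) dual (negbTE ij) !mulr0.
Qed.

Lemma value_extension p (v : tangent p) : value p (extension v) = v.
Proof.
have [e be] := tangent_basis p; have [a [va _]] := be v.
have : exists X, value p X = v.
  exists (\sum_(i < n) cinf_cst M (a 0 i) *: e i).
  by rewrite value_sum va; apply: eq_bigr => i _; rewrite valueZ.
by move=> /(xgetPex 0).
Qed.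

(** Expanding rho X in the local frame and applying L, the value of L X at p is a
    combination of the values of the L (D_i) whose coefficients X(x_i)(p) depend
    only on the value of X at p. *)
Lemma tensorial (L : vfield M -> vfield M) p X Y :
  (forall X Y, L (X + Y) = L X + L Y) -> (forall f X, L (f *: X) = f *: L X) ->
  value p X = value p Y -> value p (L X) = value p (L Y).
Proof.
move=> LD LZ XY; have [rho [x [D [r0 expand _]]]] := local_frame p.
have L0 : L 0 = 0 by apply: (@addrI _ (L 0)); rewrite -LD !addr0.
have H Z : rho p *: value p (L Z) = \sum_(i < n) value p Z (x i) *: value p (L (D i)).
  rewrite -valueZ -LZ.
  have -> : rho *: Z = \sum_(i < n) (Z (x i) : C) *: D i.
    apply: vfieldP => h; rewrite sum_vfieldE; apply: cinfP => q; rewrite cinf_sumE.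
    exact: (expand q (value q Z) h).
  rewrite (big_morph L LD L0) value_sum; apply: eq_bigr => i _.
  by rewrite LZ valueZ.
by apply: (scalerI r0); rewrite !H XY.
Qed.

End VectorFields.

Section Curvature.
Context {R : realType} {n : nat} {M : smoothManifold R n}.
Local Notation C := (Cinf M).
Variables (D : connection M).
Implicit Types (X Y Z W : vfield M) (f h : C) (p : M).

Lemma nabla0r X : D X 0 = 0.
Proof. by apply: (@addrI _ (D X 0)); rewrite -nablaDr !addr0. Qed.

Lemma nablaNr X Y : D X (- Y) = - D X Y.
Proof. by apply: (@addrI _ (D X Y)); rewrite -nablaDr !subrr nabla0r. Qed.

Lemma nabla0l X : D 0 X = 0.
Proof. by apply: (@addrI _ (D 0 X)); rewrite -nablaDl !addr0. Qed.

Lemma nablaNl X Y : D (- X) Y = - D X Y.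
Proof. by apply: (@addrI _ (D X Y)); rewrite -nablaDl !subrr nabla0l. Qed.

Definition nablaE := (nablaDl, nablaDr, nablaNl, nablaNr, nablaZl, nablaZr).

Lemma curv_field_skew X Y Z : curv_field D X Y Z = - curv_field D Y X Z.
Proof.
rewrite /curv_field.
have -> : lie X Y = - lie Y X by apply: vfieldP => h; rewrite !vfieldE; ring.
by apply: vfieldP => h; rewrite nablaNl !vfieldE; ring.
Qed.

Lemma curv_fieldD1 Y Z X X' :
  curv_field D (X + X') Y Z = curv_field D X Y Z + curv_field D X' Y Z.
Proof.
rewrite /curv_field; have -> : lie (X + X') Y = lie X Y + lie X' Y.
  by apply: vfieldP => h; rewrite !vfieldE; ring.
by apply: vfieldP => h; rewrite !nablaE !vfieldE; ring.
Qed.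

Lemma curv_fieldZ1 Y Z f X : curv_field D (f *: X) Y Z = f *: curv_field D X Y Z.
Proof.
rewrite /curv_field.
have -> : lie (f *: X) Y = f *: lie X Y - (Y f : C) *: X.
  by apply: vfieldP => h; rewrite !vfieldE; ring.
by apply: vfieldP => h; rewrite !nablaE !vfieldE; ring.
Qed.

Lemma curv_fieldD3 X Y Z Z' :
  curv_field D X Y (Z + Z') = curv_field D X Y Z + curv_field D X Y Z'.
Proof. by apply: vfieldP => h; rewrite /curv_field !nablaE !vfieldE; ring. Qed.

Lemma curv_fieldZ3 X Y f Z : curv_field D X Y (f *: Z) = f *: curv_field D X Y Z.
Proof. by apply: vfieldP => h; rewrite /curv_field !nablaE !vfieldE; ring. Qed.

Lemma curv_fieldD2 X Z Y Y' :
  curv_field D X (Y + Y') Z = curv_field D X Y Z + curv_field D X Y' Z.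
Proof.
by rewrite curv_field_skew curv_fieldD1 opprD -!(curv_field_skew X).
Qed.

Lemma curv_fieldZ2 X Z f Y : curv_field D X (f *: Y) Z = f *: curv_field D X Y Z.
Proof.
by rewrite curv_field_skew curv_fieldZ1 -scalerN -curv_field_skew.
Qed.

(** Tensoriality in each argument removes the dependence on the choice of
    extensions made by [curv_op]. *)
Lemma curv_opE p X Y Z :
  curv_op D (value p X) (value p Y) (value p Z) = value p (curv_field D X Y Z).
Proof.
rewrite /curv_op.
rewrite (tensorial (L := fun X => curv_field D X _ _)
  (curv_fieldD1 _ _) (curv_fieldZ1 _ _) (value_extension (value p X))).
rewrite (tensorial (L := fun Y => curv_field D _ Y _)
  (curv_fieldD2 _ _) (curv_fieldZ2 _ _) (value_extension (value p Y))).
exact: (tensorial (L := fun Z => curv_field D _ _ Z)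
  (curv_fieldD3 _ _) (curv_fieldZ3 _ _) (value_extension (value p Z))).
Qed.

(** Without torsion, the sum regroups into three terms equal to
    [X,[Y,Z]] and its cyclic permutations, and the Jacobi identity applies. *)
Lemma curv_field_Bianchi X Y Z : torsion_free D ->
  curv_field D X Y Z + curv_field D Y Z X + curv_field D Z X Y = 0.
Proof.
move=> TF; apply: vfieldP => h.
(* One cyclic term of the regrouped sum. *)
have J A B E : (D A (D B E)) h - (D A (D E B)) h - (D (lie B E) A) h =
    lie A (lie B E) h.
  by rewrite -!TF !nablaE !vfieldE; ring.
have := J X Y Z; have := J Y Z X; have := J Z X Y.
rewrite /curv_field !vfieldE => E3 E2 E1.
rewrite -[RHS]/(0 : C).
transitivity (((D X (D Y Z)) h - (D X (D Z Y)) h - (D (lie Y Z) X) h) +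
  ((D Y (D Z X)) h - (D Y (D X Z)) h - (D (lie Z X) Y) h) +
  ((D Z (D X Y)) h - (D Z (D Y X)) h - (D (lie X Y) Z) h)); first by ring.
by rewrite E1 E2 E3; ring.
Qed.

Variable g : metric M.
Local Notation G := (metric_cinf g).

Lemma metricDl p (x y z : tangent p) : g p (x + y) z = g p x z + g p y z.
Proof. by have [/(_ z) H _] := metric_bilin g p; have := H 1 x y; rewrite scale1r mul1r. Qed.

Lemma metricZl p a (x z : tangent p) : g p (a *: x) z = a * g p x z.
Proof.
have [/(_ z) H _] := metric_bilin g p.
have g0 : g p 0 z = 0.
  by have := H 1 0 0; rewrite scale1r mul1r addr0 -[LHS]addr0 => /addrI.
by have := H a x 0; rewrite addr0 g0 addr0.
Qed.

Lemma metricDr p (x y z : tangent p) : g p z (x + y) = g p z x + g p z y.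
Proof. by rewrite !(metric_sym g z) metricDl. Qed.

Lemma metricZr p a (x z : tangent p) : g p z (a *: x) = a * g p z x.
Proof. by rewrite !(metric_sym g z) metricZl. Qed.

Lemma metricNl p (x z : tangent p) : g p (- x) z = - g p x z.
Proof. by rewrite -scaleN1r metricZl mulN1r. Qed.

Lemma metricNr p (x z : tangent p) : g p z (- x) = - g p z x.
Proof. by rewrite -scaleN1r metricZr mulN1r. Qed.

Lemma metric_cinfDl X Y Z : G (X + Y) Z = G X Z + G Y Z.
Proof. by apply: cinfP => q /=; rewrite valueD metricDl. Qed.
Lemma metric_cinfDr X Y Z : G Z (X + Y) = G Z X + G Z Y.
Proof. by apply: cinfP => q /=; rewrite valueD metricDr. Qed.
Lemma valueN p X : value p (- X) = - value p X.
Proof. exact: tangentP. Qed.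
Lemma metric_cinfNl X Z : G (- X) Z = - G X Z.
Proof. by apply: cinfP => q /=; rewrite valueN metricNl. Qed.
Lemma metric_cinfNr X Z : G Z (- X) = - G Z X.
Proof. by apply: cinfP => q /=; rewrite valueN metricNr. Qed.

(** The Weyl condition computes X(g(Y,Z)) with a correction a(X) g(Y,Z), where
    a = -2 phi.  Expanding [X,Y] g(Z,W) in this way, all terms cancel but those
    with the curvature and the exterior derivative of a. *)
Lemma weyl_curv_field : weyl g D -> exists c : vfield M -> vfield M -> C,
  forall X Y Z W, G (curv_field D X Y Z) W + G Z (curv_field D X Y W) = c X Y * G Z W.
Proof.
move=> [TF [phi Hphi]].
pose a X : C := cinf_cst M (- 2) * MkCinf (form_smooth phi X).
have XG X Y Z : X (G Y Z) = G (D X Y) Z + G Y (D X Z) + a X * G Y Z.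
  have -> : a X * G Y Z = nabla_metric D g X Y Z.
    by apply: cinfP => q; rewrite Hphi.
  by rewrite /nabla_metric; ring.
exists (fun X Y => a (lie X Y) - (X (a Y) : C) + Y (a X)) => X Y Z W.
have := lieE X Y (G Z W).
rewrite XG (XG X) (XG Y) !vfieldD !vfieldM !XG /curv_field.
rewrite !(metric_cinfDl, metric_cinfDr, metric_cinfNl, metric_cinfNr) => E.
have close (s t s' t' : C) : s = t -> s' - t' = t - s -> s' = t'.
  by move=> ->; rewrite subrr => /subr0_eq.
by apply: (close _ _ _ _ E); ring.
Qed.


Lemma curv_multilinear p : multilinear4 (curv g D p).
Proof.
have V (v : tangent p) : v = value p (extension v) by rewrite value_extension.
have ZE (a : R) (v w : tangent p) :
    a *: v + w = value p (cinf_cst M a *: extension v + extension w).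
  by rewrite valueD valueZ !value_extension.
split=> [y z w a x x'|x z w a y y'|x y w a z z'|x y z a w w']; rewrite /curv.
- rewrite ZE (V y) (V z) curv_opE curv_fieldD1 curv_fieldZ1 valueD valueZ.
  by rewrite metricDl metricZl -!curv_opE !value_extension.
- rewrite ZE (V x) (V z) curv_opE curv_fieldD2 curv_fieldZ2 valueD valueZ.
  by rewrite metricDl metricZl -!curv_opE !value_extension.
- rewrite ZE (V x) (V y) curv_opE curv_fieldD3 curv_fieldZ3 valueD valueZ.
  by rewrite metricDl metricZl -!curv_opE !value_extension.
- by rewrite metricDr metricZr.
Qed.

Lemma curv_skew p x y z w : curv g D p x y z w = - curv g D p y x z w.
Proof. by rewrite /curv /curv_op curv_field_skew valueN metricNl. Qed.

Lemma curv_Bianchi p x y z w : torsion_free D ->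
  curv g D p x y z w + curv g D p y z x w + curv g D p z x y w = 0.
Proof.
move=> TF; rewrite /curv /curv_op -!metricDl -!valueD (curv_field_Bianchi _ _ _ TF).
have -> : value p (0 : vfield M) = 0 *: 0 by rewrite scale0r; exact: tangentP.
by rewrite metricZl mul0r.
Qed.

Lemma weyl_curv p : weyl g D -> exists c : tangent p -> tangent p -> R,
  forall x y z w, curv g D p x y z w + curv g D p x y w z = c x y * g p z w.
Proof.
move=> /weyl_curv_field [c Hc].
exists (fun x y => c (extension x) (extension y) p) => x y z w.
have := Hc (extension x) (extension y) (extension z) (extension w).
move=> /(congr1 (fun f : C => f p)).
rewrite -[LHS]/(metric_at g p _ _ + metric_at g p _ _).
rewrite -[RHS]/(c _ _ p * g p _ _) !value_extension => <-.
by rewrite /curv (metric_sym g _ z).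
Qed.

End Curvature.

(** * Curvature tensors with the symmetries of a Weyl structure *)

Section Scalar.
Context {R : realType} {V : lmodType R} (f : V -> R).
Hypothesis lf : scalar f.

Lemma scalarD x y : f (x + y) = f x + f y.
Proof. by have := lf 1 x y; rewrite scale1r mul1r. Qed.

Lemma scalar0 : f 0 = 0.
Proof. by apply: (@addrI _ (f 0)); rewrite -scalarD !addr0. Qed.

Lemma scalarZ a x : f (a *: x) = a * f x.
Proof. by have := lf a x 0; rewrite !addr0 scalar0 addr0. Qed.

Lemma scalar_lincomb n (a : 'rV[R]_n) (e : 'I_n -> V) :
  f (\sum_(i < n) a 0 i *: e i) = \sum_(i < n) a 0 i * f (e i).
Proof.
by rewrite (big_morph f scalarD scalar0); apply: eq_bigr => i _; exact: scalarZ.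
Qed.

End Scalar.

Section Contraction.
Context {R : realType} {V : lmodType R} (n : nat) (g : V -> V -> R).
Hypothesis gbil : bilin g.
Hypothesis gsym : forall x y, g x y = g y x.
Hypothesis gnd : forall x, (forall y, g x y = 0) -> x = 0.
Hypothesis has_basis : exists e : 'I_n -> V, is_basis e.

Local Notation e := (@some_basis R V n).
Local Notation Gm := (\matrix_(i, j) g (e i) (e j)).
Local Notation ginv := (inv_metric n g).

Lemma some_basisP : is_basis e.
Proof. exact: (xgetPex (fun=> 0) has_basis). Qed.

Lemma gram_sym : Gm^T = Gm.
Proof. by apply/matrixP => i j; rewrite !mxE gsym. Qed.

(** A row killed by the Gram matrix gives a vector orthogonal to everything. *)
Lemma gram_unit : Gm \in unitmx.
Proof.
rewrite -row_free_unit; apply/inj_row_free => u uG.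
have uv : \sum_(i < n) u 0 i *: e i = 0.
  apply: gnd => y; have [a [-> _]] := some_basisP y.
  rewrite (scalar_lincomb (gbil.2 _)) big1 // => j _.
  rewrite (scalar_lincomb (gbil.1 _)).
  have -> : \sum_(i < n) u 0 i * g (e i) (e j) = (u *m Gm) 0 j.
    by rewrite mxE; apply: eq_bigr => i _; rewrite mxE.
  by rewrite uG mxE mulr0.
have [a [_ Ua]] := some_basisP 0.
rewrite -(Ua u) ?uv //; apply: Ua.
by rewrite big1 // => i _; rewrite mxE scale0r.
Qed.

Lemma ginv_sym i j : ginv i j = ginv j i.
Proof. by rewrite /inv_metric -[in RHS]gram_sym -[in RHS]trmx_inv mxE. Qed.

Lemma contract_ext (b c : V -> V -> R) : (forall u v, b u v = c u v) ->
  contract n g b = contract n g c.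
Proof. by move=> bc; apply: eq_bigr => i _; apply: eq_bigr => j _; rewrite bc. Qed.

Lemma contractD (b c : V -> V -> R) :
  contract n g (fun u v => b u v + c u v) = contract n g b + contract n g c.
Proof.
rewrite /contract -big_split; apply: eq_bigr => i _ /=.
by rewrite -big_split; apply: eq_bigr => j _ /=; rewrite mulrDr.
Qed.

Lemma contractZ a (b : V -> V -> R) :
  contract n g (fun u v => a * b u v) = a * contract n g b.
Proof.
rewrite /contract mulr_sumr; apply: eq_bigr => i _ /=.
by rewrite mulr_sumr; apply: eq_bigr => j _ /=; rewrite mulrCA.
Qed.

Lemma contractN (b : V -> V -> R) :
  contract n g (fun u v => - b u v) = - contract n g b.
Proof. by rewrite -mulN1r -contractZ; apply: contract_ext => u v; rewrite mulN1r. Qed.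

Lemma contractC (b : V -> V -> R) :
  contract n g (fun u v => b v u) = contract n g b.
Proof.
rewrite /contract exchange_big; apply: eq_bigr => i _; apply: eq_bigr => j _.
by rewrite ginv_sym.
Qed.

Lemma contract_metric : contract n g g = n%:R.
Proof.
rewrite -(mxtrace1 R n) -(mulVmx gram_unit) /mxtrace; apply: eq_bigr => i _.
by rewrite mxE; apply: eq_bigr => j _; rewrite !mxE gsym.
Qed.

(** Contracting against the metric evaluates at the vector dual to g(y, .), which
    is y. *)
Lemma contract_gr (f : V -> R) y : scalar f ->
  contract n g (fun u v => f u * g y v) = f y.
Proof.
move=> lf; have [a [-> _]] := some_basisP y.
rewrite (scalar_lincomb lf) /contract; apply: eq_bigr => i _.
under eq_bigr do rewrite mulrCA (scalar_lincomb (gbil.1 _)).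
rewrite -mulr_sumr mulrC; congr (_ * _).
transitivity ((a *m (Gm *m ginv)) 0 i); last by rewrite mulmxV ?gram_unit // mulmx1.
rewrite mulmxA mxE; apply: eq_bigr => j _.
rewrite ginv_sym mulrC; congr (_ * _); rewrite mxE; apply: eq_bigr => k _.
by rewrite mxE.
Qed.

Lemma contract_gl (f : V -> R) y : scalar f ->
  contract n g (fun u v => g u y * f v) = f y.
Proof.
move=> lf; rewrite -[RHS](contract_gr y lf) -contractC; apply: contract_ext => u v.
by rewrite mulrC gsym.
Qed.

Lemma contract_skew (b : V -> V -> R) : (forall u v, b u v = - b v u) ->
  contract n g b = 0.
Proof.
move=> sb; have : contract n g b = - contract n g b.
  by rewrite -{1}contractC -contractN; apply: contract_ext => u v; exact: sb.
lra.
Qed.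

(** For skew b these are the elements of the space on which H projects. *)
Definition higa_tensor (b : V -> V -> R) x y z w : R :=
  2 * tdot b g x y z w + twedge 1 b g x y z w.

(** The wedge part is skew in z, w: the symmetrization determines b. *)
Lemma higa_tensor_swap b x y z w :
  higa_tensor b x y z w + higa_tensor b x y w z = 4 * b x y * g z w.
Proof.
by rewrite /higa_tensor /tdot /twedge (gsym w z) mulr1z; ring.
Qed.

(** The contractions of b against g add up to 2 b(y,x) + 2 b(x,y) = 0 and b is
    traceless; the trace of the metric itself gives the factor n. *)
Lemma Ric_higa_tensor b x y : bilin b -> (forall x y, b x y = - b y x) ->
  Ric n g (higa_tensor b) x y = - n%:R * b x y.
Proof.
move=> bb sb; rewrite /Ric.
rewrite (contract_ext (c := fun u v => 2 * (b u x * g y v) + (b u y * g x v +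
   (- b x y * g u v + (- g x y * b u v + g u y * b x v))))); last first.
  by move=> u v; rewrite /higa_tensor /tdot /twedge mulr1z; ring.
rewrite !contractD !contractZ contract_metric (contract_skew sb).
rewrite !contract_gr ?contract_gl; try exact: bb.1; try exact: bb.2.
by rewrite (sb y x); ring.
Qed.

Section CurvatureTensor.
Variables (A : V -> V -> V -> V -> R) (c : V -> V -> R).
Hypothesis mA : multilinear4 A.
Hypothesis skewA : forall x y z w, A x y z w = - A y x z w.
Hypothesis BianchiA : forall x y z w, A x y z w + A y z x w + A z x y w = 0.
Hypothesis weylA : forall x y z w, A x y z w + A x y w z = c x y * g z w.
Hypothesis n_gt0 : (0 < n)%N.

Let n0 : n%:R != 0 :> R.
Proof. by rewrite pnatr_eq0 -lt0n. Qed.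

(** By the Bianchi identity, Ric(x,y) - Ric(y,x) is minus the contraction of
    R(x,y,.,.), to which only the symmetric part c(x,y) g / 2 contributes. *)
Lemma asymm_Ric x y : asymm (Ric n g A) x y = - (n%:R / 4) * c x y.
Proof.
have H1 : Ric n g A x y - Ric n g A y x = - contract n g (A x y).
  rewrite /Ric -!contractN -contractD; apply: contract_ext => u v.
  have := BianchiA u x y v; rewrite (skewA y u x v); lra.
have H2 : contract n g (A x y) + contract n g (A x y) = c x y * n%:R.
  rewrite -{2}contractC -contractD -contract_metric -contractZ.
  by apply: contract_ext => u v; exact: weylA.
by rewrite /asymm H1; lra.
Qed.

Definition higa_form x y : R := - (1 / n%:R) * asymm (Ric n g A) x y.

Lemma higa_formE x y : higa_form x y = c x y / 4.
Proof. by rewrite /higa_form asymm_Ric; field. Qed.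

Lemma Ric_bilin : bilin (Ric n g A).
Proof.
have [_ m2 m3 _] := mA.
split=> [y a x x'|x a y y']; rewrite /Ric /contract mulr_sumr -big_split;
  apply: eq_bigr => i _ /=; rewrite mulr_sumr -big_split;
  apply: eq_bigr => j _ /=.
- by rewrite m2; ring.
- by rewrite m3; ring.
Qed.

Lemma higa_form_bilin : bilin higa_form.
Proof.
have [r1 r2] := Ric_bilin.
split=> [y a x x'|x a y y']; rewrite /higa_form /asymm r1 r2; ring.
Qed.

Lemma higa_form_skew x y : higa_form x y = - higa_form y x.
Proof. by rewrite /higa_form /asymm; ring. Qed.

Lemma higa_tensor_multilinear b : bilin b -> multilinear4 (higa_tensor b).
Proof.
move=> [b1 b2]; have [g1 g2] := gbil.
split=> [y z w a x x'|x z w a y y'|x y w a z z'|x y z a w w'];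
  rewrite /higa_tensor /tdot /twedge ?b1 ?b2 ?g1 ?g2; ring.
Qed.

(** The last condition on the difference, that its Ricci tensor be symmetric,
    balances -(n/4) c = - n b for R against - n b for the Higa tensor. *)
Lemma higa_spec : [set B | spaceP g B /\
  spaceA n g (fun x y z w => A x y z w - B x y z w)] (higa_tensor higa_form).
Proof.
have swapR x y z w : (A x y z w - higa_tensor higa_form x y z w) +
    (A x y w z - higa_tensor higa_form x y w z) = 0.
  have := weylA x y z w; have := higa_tensor_swap higa_form x y z w.
  rewrite higa_formE; lra.
split.
  exists higa_form; split; [exact: higa_form_bilin|exact: higa_form_skew|by []].
split; last exact: swapR.
split.
- have [a1 a2 a3 a4] := mA; have [p1 p2 p3 p4] := higa_tensor_multilinear higa_form_bilin.
  split=> [y z w a x x'|x z w a y y'|x y w a z z'|x y z a w w'].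
  + by rewrite a1 p1; ring.
  + by rewrite a2 p2; ring.
  + by rewrite a3 p3; ring.
  + by rewrite a4 p4; ring.
- move=> x y z w; rewrite skewA /higa_tensor /tdot /twedge (higa_form_skew x y); ring.
- move=> x y z w; have := BianchiA x y z w.
  rewrite /higa_tensor /tdot /twedge !mulr1z (gsym z x) (gsym z y) (gsym y x).
  rewrite (higa_form_skew y x) (higa_form_skew z x) (higa_form_skew z y); lra.
- move=> x y z w; rewrite swapR.
  have -> : asymm (Ric n g (fun x y z w => A x y z w - higa_tensor higa_form x y z w)) x y = 0.
    have E s t : Ric n g (fun x y z w => A x y z w - higa_tensor higa_form x y z w) s t =
        Ric n g A s t - Ric n g (higa_tensor higa_form) s t.
      by rewrite /Ric contractD contractN.
    have := higa_formE x y; have := asymm_Ric x y.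
    rewrite /asymm !E !(Ric_higa_tensor _ _ higa_form_bilin higa_form_skew).
    rewrite (higa_form_skew y x) => H1 H2.
    transitivity ((Ric n g A x y - Ric n g A y x) / 2 + n%:R * higa_form x y).
      by field.
    by rewrite H1 H2; field.
  by rewrite mulr0 mul0r.
Qed.

(** The symmetrization in z, w of any element that the projection may return is
    that of A, and contracting it recovers b. *)
Lemma higaE : higa n g A = higa_tensor higa_form.
Proof.
have [[b [bb sb ->]]] :
    [set B | spaceP g B /\ spaceA n g (fun x y z w => A x y z w - B x y z w)]
    (higa n g A) by apply: xgetPex; exists (higa_tensor higa_form); exact: higa_spec.
move=> [_ swap]; suff -> : b = higa_form by [].
apply/funext => x; apply/funext => y; rewrite higa_formE.
have H : contract n g (fun z w => 4 * b x y * g z w) =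
    contract n g (fun z w => c x y * g z w).
  apply: contract_ext => z w; rewrite -higa_tensor_swap -weylA.
  by have := swap x y z w; rewrite /higa_tensor; lra.
move: H; rewrite !contractZ contract_metric => /(mulIf n0) <-; by field.
Qed.

End CurvatureTensor.
End Contraction.

Theorem corollary4p4 (R : realType) (n : nat) (hn : (3 <= n)%N)
    (N : smoothManifold R n) (g : metric N) (nabla : connection N)
    (hW : weyl g nabla) (P : N) (x y z w : tangent P) :
  let Rm := curv g nabla P in
  let Rstar := conj_tensor Rm in
  let H := higa n (g P) Rm in
  [/\ g P (length_curv_op g nabla x y z) w
        = 1 / 2 * (Rm x y z w - Rstar x y z w),
      1 / 2 * (Rm x y z w - Rstar x y z w)
        = 1 / 2 * (H x y z w + H x y w z),
      g P (dir_curv_op g nabla x y z) w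
        = 1 / 2 * (Rm x y z w + Rstar x y z w) &
      1 / 2 * (Rm x y z w + Rstar x y z w)
        = alpha1 n (g P) Rm x y z w + alpha2 n (g P) Rm x y z w
          + alpha6 n (g P) Rm x y z w
          + 1 / 2 * (H x y z w - H x y w z)].
Proof.
move=> Rm Rstar H.
have [c Hc] := weyl_curv P hW.
have n_gt0 : (0 < n)%N by apply: leq_trans hn.
have be : exists e : 'I_n -> tangent P, is_basis e.
  by have [e ?] := tangent_basis P; exists (fun i => value P (e i)).
have gs : forall u v, g P u v = g P v u := @metric_sym _ _ _ g P.
have sk := @curv_skew _ _ _ nabla g P.
have Bi u v s t := curv_Bianchi g (p := P) u v s t hW.1.
have HE : H = higa_tensor (g P) (higa_form n (g P) Rm).
  exact: (higaE (metric_bilin g P) gs (@metric_nondeg _ _ _ g P) be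
    (curv_multilinear nabla g P) sk Bi Hc n_gt0).
have n0 : n%:R != 0 :> R by rewrite pnatr_eq0 -lt0n.
have n1 : n%:R - 1 != 0 :> R by rewrite subr_eq0 (eqr_nat R n 1) gtn_eqF // ltnW.
have n2 : n%:R - 2 != 0 :> R by rewrite subr_eq0 (eqr_nat R n 2) gtn_eqF.
have S : Rm x y w z = - (4 / n%:R) * asymm (Ric n (g P) Rm) x y * g P z w
    - Rm x y z w.
  rewrite (asymm_Ric (metric_bilin g P) gs (@metric_nondeg _ _ _ g P) be sk Bi Hc).
  by apply: (@addrI _ (Rm x y z w)); rewrite Hc addrC subrK; field.
have F : g P (length_curv_op g nabla x y z) w = 1 / 2 * (Rm x y z w - Rstar x y z w).
  by rewrite metricZl /length_curv /Rstar /conj_tensor S; field.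
split; first exact: F.
- rewrite HE higa_tensor_swap // /Rstar /conj_tensor S /higa_form; by field.
- rewrite metricDl metricNl F -[g P (curv_op _ _ _ _) w]/(Rm x y z w); by field.
- rewrite HE /Rstar /conj_tensor S /alpha1 /alpha2 /alpha6 /higa_tensor /higa_form.
  rewrite /tdot /twedge /= !mulr1z mulr0z (gs w z).
  by field; rewrite n0 n1 n2.
Qed.
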